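(* Let $n\geq 1$. The $(n,n)$ Springer variety $\mathfrak{B}_{n,n}$ and the topological space $\widetilde{S}=\bigcup_{a\in B^n}S_a\subset(\mathbb{P}^1)^{2n}$ are homeomorphic.
   Context: Let $E_n$ be a complex vector space of dimension $2n$ and $z_n\colon E_n\to E_n$ a nilpotent linear endomorphism with exactly two nilpotent Jordan blocks, each of size $n$. A complete flag in $E_n$ is an ascending sequence of linear subspaces $0\subsetneq L_1\subsetneq L_2\subsetneq\ldots\subsetneq L_{2n}=E_n$. The $(n,n)$ Springer variety is $$\mathfrak{B}_{n,n}:=\{\text{complete flags } (L_1,\ldots,L_{2n}) \text{ in } E_n \text{ with } z_nL_j\subset L_j \text{ for all } j\in\{1,\ldots,2n\}\},$$ a complex projective variety, with the (classical, analytic) topology it inherits as a subspace of the variety of complete flags in $E_n$. $\mathbb{P}^1$ denotes the complex projective line, i.e. the set of complex lines (one-dimensional linear subspaces) in $\mathbb{C}^2$, with its classical topology, and $(\mathbb{P}^1)^{2n}$ is the product of $2n$ copies of it. $B^n$ is the set of crossingless matchings of $2n$ points: partitions of $\{1,2,\ldots,2n\}$ into pairs such that there is no quadruple $i<j<k<l$ with $(i,k)$ and $(j,l)$ paired. For $a\in B^n$, let $O_a$ be the set of all $i$ appearing in a pair $(i,j)\in a$ with $i<j$; for such a pair put $s_a(i):=j$. Define $$S_a:=\{(l_1,\ldots,l_{2n})\in(\mathbb{P}^1)^{2n}\colon l_j=l_{s_a(j)}\ \forall j\in O_a\},$$ and give $\widetilde{S}:=\bigcup_{a\in B^n}S_a$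 the subspace topology from $(\mathbb{P}^1)^{2n}$. *)

(* Defs.v *)
From HB Require Import structures.
From mathcomp Require Import all_boot all_order all_algebra.
From mathcomp Require Import complex.
From mathcomp Require Import all_classical all_reals.
From mathcomp Require Import topology normedtype.

Set Implicit Arguments.
Unset Strict Implicit.
Unset Printing Implicit Defensive.

Import Order.TTheory GRing.Theory Num.Theory.
Import numFieldNormedType.Exports.

Local Open Scope classical_set_scope.
Local Open Scope ring_scope.
Local Open Scope complex_scope.

Definition homeomorphic (X Y : topologicalType) : Prop :=
  exists (f : X -> Y) (g : Y -> X),
    [/\ cancel f g, cancel g f, continuous f & continuous g].

(* The norm topology of C, as provided by the library on the regular module
   of any numFieldType. *)
HB.instance Definition _ (R : realType) := NormedModule.copy R[i] (R[i])^o.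

Section Grassmannian.
Context {R : realType} {E : vectType R[i]}.

(* Frames are written in coordinates with respect to a fixed basis of E; the
   topology obtained on {vspace E} does not depend on that basis. *)
Definition frame (k : nat) : Type :=
  [set A : 'M[R[i]]_(k, \dim {:E}) | row_free A].

HB.instance Definition _ k := Topological.on (frame k).

Definition frame_span k (A : frame k) : {vspace E} :=
  <<[tuple passmx.vecof (vbasis {:E}) (row i (\val A)) | i < k]>>%VS.

(* The classical topology on Grassmannians: Gr(k, E) carries the quotient
   topology from the space of k-frames, and {vspace E}, the set of all
   subspaces, is the topological disjoint union of the Gr(k, E). *)
Definition vspace_open (U : set {vspace E}) : Prop :=
  forall k, open (@frame_span k @^-1` U).

Lemma vspace_openT : vspace_open setT.
Proof. by move=> k; rewrite preimage_setT; exact: openT. Qed.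

Lemma vspace_openI : setI_closed vspace_open.
Proof. by move=> U V oU oV k; rewrite preimage_setI; exact: openI. Qed.

Lemma vspace_open_bigcup (I : Type) (U : I -> set {vspace E}) :
  (forall i, vspace_open (U i)) -> vspace_open (\bigcup_i U i).
Proof.
by move=> oU k; rewrite preimage_bigcup; apply: bigcup_open => i _; exact: oU.
Qed.

HB.instance Definition _ := isOpenTopological.Build {vspace E}
  vspace_openT vspace_openI vspace_open_bigcup.

End Grassmannian.

Section Springer.
Context {R : realType} {E : vectType R[i]}.

(* e_0, ..., e_(n-1) is the basis of a nilpotent Jordan block of z:
   e_(n-1) |-> ... |-> e_1 |-> e_0 |-> 0. *)
Definition nilpotent_Jordan_block (z : 'End(E)) n (e : n.-tuple E) : Prop :=
  forall i, (i < n)%N -> z e`_i = if i is i'.+1 then e`_i' else 0.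

Definition two_equal_Jordan_blocks n (z : 'End(E)) : Prop :=
  exists e f : n.-tuple E,
    [/\ basis_of {:E} (e ++ f),
        nilpotent_Jordan_block z e & nilpotent_Jordan_block z f].

(* L_1, ..., L_m is indexed from 0, i.e. L_(j+1) is written L j. *)
Definition complete_flag m (L : 'I_m -> {vspace E}) : Prop :=
  [/\ forall j : 'I_m, j = 0%N :> nat -> L j != 0%VS,
      forall i j : 'I_m, (i < j)%N -> (L i <= L j)%VS /\ L i != L j
    & forall j : 'I_m, j.+1 = m -> L j = fullv].

Definition Springer n (z : 'End(E)) :
    set (prod_topology (fun _ : 'I_(2 * n) => {vspace E})) :=
  [set L | complete_flag L /\ forall j, (z @: L j <= L j)%VS].

End Springer.

Arguments Springer {R E} n z.

Definition P1 (R : realType) : Type :=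
  [set l : {vspace 'rV[R[i]]_2} | \dim l = 1%N].

HB.instance Definition _ R := Topological.on (P1 R).

Definition crossingless_matchings n : set {set {set 'I_(2 * n)}} :=
  [set a | [/\ finset.partition a [set: 'I_(2 * n)]%SET,
               forall p, p \in a -> #|p| = 2%N
             & ~ exists i j k l : 'I_(2 * n),
                 [/\ (i < j < k)%N, (k < l)%N,
                     [set i; k]%SET \in a & [set j; l]%SET \in a]]].

Arguments crossingless_matchings n : clear implicits.

Section TopologicalModel.
Context {R : realType} {n : nat}.
Implicit Types (a : {set {set 'I_(2 * n)}}) (i j : 'I_(2 * n)).

Definition left_ends a : {set 'I_(2 * n)} :=
  [set i : 'I_(2 * n) |
     [exists j : 'I_(2 * n), (i < j)%N && ([set i; j]%SET \in a)]]%SET.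

(* The default value i is irrelevant: only i \in left_ends a are used. *)
Definition partner a i : 'I_(2 * n) :=
  odflt i [pick j : 'I_(2 * n) | (i < j)%N && ([set i; j]%SET \in a)].

Definition S_ a : set (prod_topology (fun _ : 'I_(2 * n) => P1 R)) :=
  [set l | forall j, j \in left_ends a -> l j = l (partner a j)].

End TopologicalModel.

Definition S_tilde (R : realType) (n : nat) :
    set (prod_topology (fun _ : 'I_(2 * n) => P1 R)) :=
  \bigcup_(a in crossingless_matchings n) S_ a.

Arguments S_tilde R n : clear implicits.

(* Main.v *)
Require Import Defs.
From HB Require Import structures.
From mathcomp Require Import all_boot all_order all_algebra.
From mathcomp Require Import complex spectral sesquilinear zify.
From mathcomp Require Import all_classical all_reals.
From mathcomp Require Import topology normedtype.

(** The proof describes a Springer flag by a word of lines in C^2.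

    Choose a Jordan basis and write E = C^2 tensor C[t]/t^n, where z is
    multiplication by t and the two chains are the powers of t times the two
    basis vectors of C^2.  For a line l in C^2 with orthogonal projector P put
    [shrink P = P + t (1 - P)].  This endomorphism commutes with t, its image is
    the hyperplane l + t E ([shrink_eqmx]), and [shrink (1 - P)] times
    [shrink P] is t ([shrinkC]).

    Read a flag downwards from E.  If one of its terms is the image of E under
    an endomorphism G commuting with t, then the next term, pulled back along
    G, is a t-stable hyperplane of E.  As t is nilpotent this hyperplane
    contains t E, so that it is the image of [shrink P] for exactly one line
    ([step_exists], [step_formula]).  Thus the flags are the chains of images
    of the prefixes of words of 2n lines, and the words that occur are those
    whose whole product is 0, since each letter lowers the rank by at most one
    ([exists_word], [word_flag]).

    When does a product of 2n letters vanish?  Modulo t it is a product of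
    rank one projectors, and this vanishes only if two neighbouring lines are
    orthogonal ([proj_word_eq0]).  Such a pair contributes a factor t, and one
    cancels it and goes on with 2n - 2 letters and t^(n-1).  Hence the product
    vanishes exactly when the word cancels completely by removing orthogonal
    neighbours ([word_reducible], [reducible_word]).  Replacing every other
    line by its orthogonal complement ([twist]) turns orthogonal neighbours into
    equal ones, and a word cancels completely by removing equal neighbours
    exactly when it is constant on the arcs of a crossingless matching
    ([constant_on_matching]).  This is the bijection with S-tilde.

    For the topology, two facts about Grassmannians suffice.  The orthogonal
    projector onto the row space of a frame A is A^* (A A^* )^-1 A, so that it
    depends continuously on the subspace ([continuous_coord_proj]); and the row
    space of a matrix of constant rank that varies continuously varies
    continuously ([continuous_row_space]).  The terms of the flag are row
    spaces of polynomial expressions in the projectors of the lines.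
    Conversely each line is the row space of a matrix of rank one, polynomial
    in the previous lines and in the projectors of the flag ([next_line]), so
    that the lines depend continuously on the flag, one after the other. *)

Set Implicit Arguments.
Unset Strict Implicit.
Unset Printing Implicit Defensive.
Import Order.TTheory GRing.Theory Num.Theory numFieldNormedType.Exports passmx.

(** * Reduction of words and crossingless matchings *)

(** Triviality of a word in the free product of copies of Z/2 indexed by T. *)
Inductive reducible (T : Type) : seq T -> Prop :=
| reducible_nil : reducible [::]
| reducible_pair u x v : reducible (u ++ v) -> reducible (u ++ x :: x :: v).

(** A crossingless matching of 0, ..., N-1 as the involution that exchanges
    the ends of each arc.  Indexing by nat makes the insertion of an arc a mere
    shift of indices. *)
Definition matching (N : nat) (m : nat -> nat) : Prop :=
  [/\ forall k, k < N -> m k < N, forall k, k < N -> m (m k) = k,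
      forall k, k < N -> m k <> k
    & forall i j, i < j -> j < m i -> m i < m j -> m j < N -> False].

Lemma reducible_insert (T : Type) (a u b : seq T) :
  reducible u -> reducible (a ++ b) -> reducible (a ++ u ++ b).
Proof.
move=> ru rab; suff : forall a b, reducible (a ++ b) -> reducible (a ++ u ++ b) by apply.
elim: ru => {a b rab} // p x q _ IH a b rab.
rewrite -catA !cat_cons catA; apply: reducible_pair; rewrite -catA (catA p).
exact: IH.
Qed.

(** In an interval closed under m, the arc that starts at the first letter
    separates two closed intervals, the letters under it and those after it,
    because nothing crosses it.  Both cancel by induction on the length, and
    then the two ends of the arc cancel. *)
Lemma reducible_of_matching (T : Type) N m (t : nat -> T) : matching N m ->
  (forall k, k < N -> t (m k) = t k) -> reducible [seq t k | k <- iota 0 N].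
Proof.
move=> [mN mK m_neq m_cross] tm.
suff red len : forall i, i + len <= N ->
    (forall k, i <= k < i + len -> i <= m k < i + len) ->
    reducible [seq t k | k <- iota i len].
  by apply: red => // k /=; apply: mN.
have [B] := ubnP len; elim: B len => // B IH [|len] /= lenB i iN mcl.
  exact: reducible_nil.
have hi : i <= m i < i + len.+1 by apply: mcl; lia.
have hn : m i <> i by apply: m_neq; lia.
have mKi : m (m i) = i by apply: mK; lia.
(* The lengths of the parts under and after the arc from i to m i. *)
pose p := m i - i.+1; pose q := i + len.+1 - (m i).+1.
have -> : len = p + q.+1 by rewrite /p /q; lia.
have -> : i.+1 = m i - p by rewrite /p; lia.
rewrite iotaD map_cat.
have -> : m i - p + p = m i by rewrite /p; lia.
rewrite /= tm; last by lia.
have mKx x : i <= x < i + len.+1 -> m (m x) = x by move=> ?; apply: mK; lia.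
apply: (@reducible_insert _ [:: t i] _ (t i :: _)); last first.
  apply: (@reducible_pair _ [::]) => /=; apply: IH; rewrite /q; try lia.
  move=> x xin; have mx : i <= m x < i + len.+1 by apply: mcl; lia.
  have mxx := mKx x ltac:(lia).
  have [e|ne] := eqVneq (m x) i; first by rewrite e in mxx; lia.
  have [e|ne'] := eqVneq (m x) (m i); first by rewrite e in mxx; lia.
  have [h|h] := ltnP (m x) (m i); last by lia.
  by have /(_ i (m x)) := m_cross; lia.
apply: IH; rewrite /p; try lia.
move=> x xin; have mx : i <= m x < i + len.+1 by apply: mcl; lia.
have mxx := mKx x ltac:(lia).
have [e|ne] := eqVneq (m x) i; first by rewrite e in mxx; lia.
have [e|ne'] := eqVneq (m x) (m i); first by rewrite e in mxx; lia.
have [h|h] := ltnP (m i) (m x); last by lia.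
by have /(_ i x) := m_cross; lia.
Qed.

(** Undoing a cancellation inserts an arc between the neighbours i and i+1;
    the other arcs are transported along the increasing map h that avoids
    these two places. *)
Lemma matching_of_reducible (T : Type) (x0 : T) (s : seq T) : reducible s ->
  exists2 m, matching (size s) m &
    forall k, k < size s -> nth x0 s (m k) = nth x0 s k.
Proof.
elim=> [|u x v _ [m [mN mK m_neq m_cross] ms]]; first by exists id; split.
pose i := size u; pose h k := if k < i then k else k.+2.
(* The inverse of h away from i and i+1. *)
pose g k := if k < i then k else k.-2.
pose m' k := if k == i then i.+1 else if k == i.+1 then i else h (m (g k)).
have szE : size (u ++ x :: x :: v) = (size (u ++ v)).+2.
  by rewrite !size_cat /= !addnS.
have iN : i <= size (u ++ v) by rewrite size_cat leq_addr.
have nthh k : nth x0 (u ++ x :: x :: v) (h k) = nth x0 (u ++ v) k.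
  rewrite !nth_cat /h -/i; have [ki|ik] := ltnP k i; first by rewrite ki.
  by rewrite ltnNge (leq_trans ik (leq_addl 2 k)) /= -add2n -addnBA.
have m'E k : m' k = if k == i then i.+1 else if k == i.+1 then i else
   h (m (g k)) by [].
have hE k : h k = if k < i then k else k.+2 by [].
have gE k : g k = if k < i then k else k.-2 by [].
have gN k : k < (size (u ++ v)).+2 -> k <> i -> k <> i.+1 -> g k < size (u ++ v).
  by rewrite gE; case: ifP; lia.
have gh k : g (h k) = k by rewrite gE hE; do 2 case: ifP; lia.
have hg k : k <> i -> k <> i.+1 -> h (g k) = k by rewrite gE hE; do 2 case: ifP; lia.
have hi k : h k <> i by rewrite hE; case: ifP; lia.
have hi1 k : h k <> i.+1 by rewrite hE; case: ifP; lia.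
have hN k : k < size (u ++ v) -> h k < (size (u ++ v)).+2 by rewrite hE; case: ifP; lia.
have hlt k l : (h k < h l) = (k < l) by rewrite !hE; do 2 case: ifP; lia.
rewrite szE; clearbody m' h g; exists m'; first split.
- move=> k kN; rewrite m'E; case: eqP => [|ki]; first by lia.
  case: eqP => [|ki1]; first by lia.
  by apply: hN; apply: mN; apply: gN.
- move=> k kN; rewrite (m'E k); case: eqP => [->|ki].
    by rewrite m'E eqxx; case: eqP; lia.
  case: eqP => [->|ki1]; first by rewrite m'E eqxx.
  rewrite m'E; case: eqP => [/hi//|_]; case: eqP => [/hi1//|_].
  by rewrite gh mK ?hg//; apply: gN.
- move=> k kN; rewrite m'E; case: eqP => [->|ki]; first by lia.
  case: eqP => [->|ki1]; first by lia.
  by move=> e; case: (m_neq (g k) (gN _ kN ki ki1)); rewrite -[LHS]gh e.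
- move=> a b ab bma mab mbN.
  have mm := m'E a; have mb := m'E b.
  case: (a =P i) mm ab bma mab => [->|ai] mm ab bma mab; first by lia.
  case: (a =P i.+1) mm ab bma mab => [->|ai1] mm ab bma mab; first by lia.
  case: (b =P i) mb ab bma mab mbN => [->|bi] mb ab bma mab mbN.
    by have := hi (m (g a)); have := hi1 (m (g a)); lia.
  case: (b =P i.+1) mb ab bma mab mbN => [->|bi1] mb ab bma mab mbN; first by lia.
  apply: (m_cross (g a) (g b)).
  + by rewrite -hlt !hg.
  + by rewrite -hlt hg// -mm.
  + by rewrite -hlt -mm -mb.
  + by apply: mN; apply: gN => //; lia.
move=> k kN; rewrite m'E.
have xi : nth x0 (u ++ x :: x :: v) i = x by rewrite nth_cat ltnn subnn.
have xi1 : nth x0 (u ++ x :: x :: v) i.+1 = x.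
  by rewrite nth_cat ltnNge leqnSn subSnn.
case: eqP => [->|ki]; first by rewrite xi xi1.
case: eqP => [->|ki1]; first by rewrite xi xi1.
by rewrite nthh ms ?gN// -nthh hg.
Qed.

Section SetPartitions.
Variable n : nat.
Implicit Types (a : {set {set 'I_(2 * n)}}) (i j : 'I_(2 * n)).

Lemma crossingless_mate a i : crossingless_matchings n a ->
  exists2 j, j != i & [set i; j]%SET \in a.
Proof.
move=> [pa ca _]; have [_ _ ] := and3P pa.
have iin : i \in finset.cover a by rewrite (finset.cover_partition pa) finset.in_setT.
have pin := pblock_mem iin; move=> _.
have : i \in finset.pblock a i by rewrite finset.mem_pblock.
have /eqP/cards2P[x [y [xy pE]]] := ca _ pin.
rewrite pE !inE => /orP[/eqP ix|/eqP iy].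
  by exists y; rewrite ?ix 1?eq_sym// -pE.
by exists x; rewrite ?iy// finset.setUC -pE.
Qed.

Lemma crossingless_uniq a i j k : crossingless_matchings n a ->
  [set i; j]%SET \in a -> [set i; k]%SET \in a -> j != i -> j = k.
Proof.
move=> [pa _ _] ija ika ji; have /and3P[_ tI _] := pa.
have e1 : finset.pblock a i = [set i; j]%SET
  by apply: finset.def_pblock; rewrite ?inE ?eqxx.
have e2 : finset.pblock a i = [set i; k]%SET
  by apply: finset.def_pblock; rewrite ?inE ?eqxx.
have : j \in [set i; k]%SET by rewrite -e2 e1 !inE eqxx orbT.
by rewrite !inE (negbTE ji) => /eqP.
Qed.

Lemma matching_of_crossingless a : crossingless_matchings n a ->
  exists2 m, matching (2 * n) m &
    forall i, exists2 j : 'I_(2 * n), m i = j & [set i; j]%SET \in a.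
Proof.
move=> ca; have /choice[mo moP] : forall i, exists j, j != i /\ [set i; j]%SET \in a.
  by move=> i; have [j] := crossingless_mate i ca; exists j.
have moK i : mo (mo i) = i.
  apply: (crossingless_uniq ca) (moP (mo i)).2 _ (moP (mo i)).1.
  by rewrite finset.setUC; exact: (moP i).2.
pose m k := if insub k is Some i then val (mo i) else k.
have mE i : m i = mo i by rewrite /m valK.
exists m; last by move=> i; exists (mo i); [exact: mE|exact: (moP i).2].
have mOrd k (kN : k < 2 * n) : m k = mo (Ordinal kN) by rewrite -mE.
split.
- by move=> k kN; rewrite (mOrd k kN).
- by move=> k kN; rewrite (mOrd k kN) mE moK.
- move=> k kN; rewrite (mOrd k kN) => e.
  by case/eqP: (moP (Ordinal kN)).1; apply: val_inj.
- move=> i j ij jmi mij mjN; have mN : m i < 2 * n := ltn_trans mij mjN.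
  have jN := ltn_trans jmi mN; have iN := ltn_trans ij jN.
  have [_ _] := ca; apply; move: jmi mij; rewrite (mOrd i iN) (mOrd j jN) => jmi mij.
  exists (Ordinal iN), (Ordinal jN), (mo (Ordinal iN)), (mo (Ordinal jN)).
  by split; [apply/andP; split|..] => //; exact: (moP _).2.
Qed.

Lemma crossingless_of_matching m : matching (2 * n) m ->
  exists2 a, crossingless_matchings n a &
    forall i, i \in left_ends a -> partner a i = m i :> nat.
Proof.
move=> [mN mK m_neq m_cross].
pose mo i : 'I_(2 * n) := Ordinal (mN i (ltn_ord i)).
have moK i : mo (mo i) = i by apply: val_inj; rewrite /= mK.
have mo_neq i : mo i != i by apply/eqP => /(congr1 val); exact: m_neq.
pose a := [set [set i; mo i] | i : 'I_(2 * n)]%SET.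
have aP i j : [set i; j]%SET \in a -> i != j -> j = mo i.
  move=> /imsetP[k _ /setP e] ij.
  have := e i; have := e j; rewrite !inE !eqxx /= orbT.
  by move=> /esym/orP[]/eqP jE /esym/orP[]/eqP iE; move: ij; rewrite jE iE ?eqxx ?moK.
exists a; first split.
- apply/and3P; split.
  + apply/eqP/setP => i; rewrite finset.in_setT; apply/finset.bigcupP.
    by exists [set i; mo i]%SET; [exact: imset_f|rewrite !inE eqxx].
  + apply/finset.trivIsetP => _ _ /imsetP[i _ ->] /imsetP[j _ ->] ne.
    apply/pred0P => k /=; rewrite !inE; apply/negP => /andP[ki kj].
    move/negP: ne; apply; apply/eqP.
    have [e|e] : i = j \/ i = mo j; last by rewrite e moK finset.setUC.
      case/orP: ki kj => /eqP-> /orP[]/eqP e; [by left|by right| |left].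
        by right; rewrite -e moK.
      by rewrite -[LHS]moK e moK.
    by rewrite e.
  + by apply/imsetP => -[i _ /setP/(_ i)]; rewrite !inE eqxx.
- by move=> _ /imsetP[i _ ->]; rewrite cards2 eq_sym mo_neq.
- move=> [i [j [k [l [/andP[ij jk] kl ika jla]]]]].
  have kE := aP _ _ ika ltac:(by rewrite -(inj_eq val_inj) /= neq_ltn (ltn_trans ij jk)).
  have lE := aP _ _ jla ltac:(by rewrite -(inj_eq val_inj) /= neq_ltn (ltn_trans jk kl)).
  move: jk kl; rewrite kE lE => jk kl.
  by apply: (m_cross i j) => //; exact: (mN j).
move=> i; rewrite inE /partner => /existsP[j ij].
case: pickP => [k|/(_ j)] /=; last by rewrite ij.
by move=> /andP[ik ika]; rewrite (aP _ _ ika)// -(inj_eq val_inj) /= neq_ltn ik.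
Qed.

(** The ends of the arcs cancel, innermost arcs first. *)
Lemma constant_on_matching (T : Type) (l : 'I_(2 * n) -> T) :
  (exists2 a, crossingless_matchings n a &
     forall j, j \in left_ends a -> l j = l (partner a j)) <->
  reducible [seq l i | i <- enum 'I_(2 * n)].
Proof.
have [n0|n0] := posnP (2 * n).
  have e : enum 'I_(2 * n) = [::] by apply: size0nil; rewrite size_enum_ord.
  rewrite e; split => [_|_]; first exact: reducible_nil.
  have [|a ca _] := @crossingless_of_matching id; first by rewrite n0; split.
  by exists a => // j; have := ltn_ord j; rewrite {2}n0.
pose x0 : 'I_(2 * n) := Ordinal n0.
pose t k := l (nth x0 (enum 'I_(2 * n)) k).
have tE i : t i = l i by rewrite /t nth_ord_enum.
have sE : [seq l i | i <- enum 'I_(2 * n)] = [seq t k | k <- iota 0 (2 * n)].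
  apply: (@eq_from_nth _ (l x0)).
    by rewrite [LHS]size_map [RHS]size_map size_enum_ord size_iota.
  move=> k; rewrite size_map size_enum_ord => kN.
  rewrite (nth_map x0) ?size_enum_ord// (nth_map 0) ?size_iota//.
  by rewrite nth_iota.
rewrite sE; split=> [[a ca la]|rs].
  have [m mm ma] := matching_of_crossingless ca.
  apply: (reducible_of_matching mm) => k kN.
  have [mN mK m_neq _] := mm.
  have la' i j : (i < j)%N -> [set i; j]%SET \in a -> l i = l j.
    move=> ij ija; have il : i \in left_ends a.
      by rewrite inE; apply/existsP; exists j; rewrite ij.
    rewrite la// /partner.
    case: pickP => [h /andP[ih iha]|/(_ j)] /=; last by rewrite ij ija.
    congr l; apply: (crossingless_uniq ca iha ija).
    by rewrite -(inj_eq val_inj) neq_ltn ih orbT.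
  have [j mj ja] := ma (Ordinal kN); rewrite /= in mj.
  rewrite mj tE -[k]/(val (Ordinal kN)) tE.
  have [h|h|h] := ltngtP j k; last by case: (m_neq _ kN); rewrite mj.
    by apply: la' => //; rewrite finset.setUC.
  by apply/esym; apply: la'.
have [m mm ms] := matching_of_reducible (l x0) rs.
rewrite size_map size_iota in mm ms.
have [a ca pa] := crossingless_of_matching mm; exists a => // j jl.
have [mN _ _ _] := mm.
have := ms _ (ltn_ord j); rewrite !(nth_map 0) ?size_iota ?mN//.
by rewrite !nth_iota ?mN// !add0n tE -(pa _ jl) tE => ->.
Qed.
End SetPartitions.

(** * Orthogonal projectors *)

Local Open Scope ring_scope.

Section OrthogonalProjectors.
Context {C : numClosedFieldType}.

(** A projector is determined by its image and its kernel. *)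
Lemma eq_proj_ortho m p n (U : 'M[C]_(m, n)) (V : 'M_(p, n)) :
  (U :=: V)%MS -> proj_ortho U = proj_ortho V.
Proof.
move=> UV.
have eU : proj_ortho U *m proj_ortho V = proj_ortho U.
  by rewrite proj_ortho_id// proj_orthoE UV.
have : (1%:M - 1%:M *m proj_ortho U) *m proj_ortho V = 0.
  apply: proj_ortho_0; apply: submx_trans (proj_ortho_compl_sub _ _) _.
  by rewrite submx_ortho UV.
by move/eqP; rewrite mulmxBl !mul1mx eU subr_eq0 => /eqP.
Qed.

Local Open Scope sesquilinear_scope.

(** If u A A^* = 0, then u A lies both in the row space of A and in its
    orthogonal complement. *)
Lemma gram_unit m n (A : 'M[C]_(m, n)) : row_free A -> A *m A ^t* \in unitmx.
Proof.
move=> fA; rewrite -row_free_unit -kermx_eq0.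
have : (kermx (A *m A ^t*) *m A <= A :&:
    orthomx Num.Def.conjC (mx_of_hermitian (hermitian1mx _)) A)%MS.
  by rewrite sub_capmx submxMl /=; apply/orthomx1P; rewrite -mulmxA mulmx_ker.
by rewrite orthomx_ortho_disj submx0 mulmx_free_eq0.
Qed.

(** The formula from which continuity of the projector is read off. *)
Lemma proj_ortho_gram m n (A : 'M[C]_(m, n)) : row_free A ->
  proj_ortho A = A ^t* *m invmx (A *m A ^t*) *m A.
Proof.
move=> fA; set Q := RHS.
have QA : (Q <= A)%MS by exact: submxMl.
have oQ : (1%:M - Q <= orthomx Num.Def.conjC (mx_of_hermitian (hermitian1mx _)) A)%MS.
  apply/orthomx1P; rewrite mulmxBl mul1mx /Q -!mulmxA mulVmx ?gram_unit//.
  by rewrite mulmx1 subrr.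
rewrite -[LHS]mul1mx -[X in X *m _](subrK Q) mulmxDl.
by rewrite proj_ortho_0// add0r proj_ortho_id.
Qed.

(** A line in C^2, encoded by the orthogonal projector onto it. *)
Definition line_proj (P : 'M[C]_2) : Prop :=
  proj_ortho P = P /\ \rank P = 1%N.

Lemma line_projM P : line_proj P -> P * P = P.
Proof. by move=> [<- _]; rewrite -mulmxE proj_ortho_proj. Qed.

Lemma line_projN0 P : line_proj P -> P != 0.
Proof. by move=> [_ rP]; rewrite -mxrank_eq0 rP. Qed.

Lemma line_proj_of m (U : 'M[C]_(m, 2)) : \rank U = 1%N -> line_proj (proj_ortho U).
Proof.
move=> rU; split; last by rewrite proj_orthoE.
by apply: eq_proj_ortho; exact: proj_orthoE.
Qed.

Lemma line_projC P : line_proj P -> line_proj (1 - P).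
Proof.
move=> [eP rP].
have e : proj_ortho (orthomx Num.Def.conjC (mx_of_hermitian (hermitian1mx _)) P) =
    1 - P.
  have := add_proj_ortho P (1%:M : 'M_2); rewrite !mul1mx eP => PQ.
  by apply/eqP; rewrite eq_sym subr_eq addrC; apply/eqP/esym.
by rewrite -e; apply: line_proj_of; rewrite rank_ortho rP.
Qed.

(** The image of P is contained in the kernel of Q, and both are lines. *)
Lemma line_proj_mul0 P Q : line_proj P -> line_proj Q -> P * Q = 0 -> P = 1 - Q.
Proof.
move=> lP lQ PQ0; have [eP rP] := lP; have [eQ' rQ'] := line_projC lQ.
rewrite -eP -eQ'; apply: eq_proj_ortho; apply/eqmxP.
rewrite -mxrank_leqif_eq ?rP ?rQ'//; apply/submxP; exists P.
by rewrite mulmxE mulrBr PQ0 subr0 mulr1.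
Qed.
End OrthogonalProjectors.

(** * Words of lines *)

(** The model is C^2 tensor C[t]/t^n, in row vectors: Z is multiplication
    by t, D Q is Q tensor 1, and the rows of iota span the constants
    C^2 tensor 1. *)
Section Words.
Context {C : numClosedFieldType} {d n' : nat}.
Let n := n'.+1.
Variables (Z : 'M[C]_d) (D : {rmorphism 'M[C]_2 -> 'M[C]_d}) (iota : 'M[C]_(2, d)).
Hypotheses (DZ : forall Q, D Q * Z = Z * D Q)
  (iotaD : forall Q, iota *m D Q = Q *m iota).

(** The elementary modification P + t (1 - P) of lattices over C[t]. *)
Definition shrink P : 'M[C]_d := D P + Z * D (1 - P).

(** Complementing every other letter turns the cancellation of orthogonal
    neighbours into that of equal ones. *)
Definition twist (b : bool) (P : 'M[C]_2) := if b then 1 - P else P.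

(** Matrices act on row vectors from the right, so that a further letter
    multiplies on the left and makes the row space smaller. *)
Fixpoint word b s : 'M[C]_d :=
  if s is P :: s' then word (~~ b) s' * shrink (twist b P) else 1.

Lemma twistK b : involutive (twist b).
Proof. by case: b => P //=; rewrite opprB addrC subrK. Qed.

Lemma line_twist b P : line_proj P -> line_proj (twist b P).
Proof. by case: b => //=; exact: line_projC. Qed.

Lemma twistN b P : twist (~~ b) P = 1 - twist b P.
Proof. by case: b => //=; rewrite opprB addrC subrK. Qed.

Lemma shrinkZ P : shrink P * Z = Z * shrink P.
Proof. by rewrite /shrink mulrDl mulrDr DZ -mulrA DZ. Qed.

Lemma shrinkC P : line_proj P -> shrink (1 - P) * shrink P = Z.
Proof.
move=> lP; have PP := line_projM lP.
have PC : P * (1 - P) = 0 by rewrite mulrBr mulr1 PP subrr.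
have CP : (1 - P) * P = 0 by rewrite mulrBl mul1r PP subrr.
have CC : (1 - P) * (1 - P) = 1 - P by rewrite {1}mulrBl mul1r PC subr0.
rewrite /shrink opprB [X in _ + Z * D X]addrC subrK.
rewrite mulrDl !mulrDr -!rmorphM CP rmorph0 add0r.
rewrite mulrA DZ -(mulrA Z) -rmorphM CC.
rewrite -(mulrA Z) -rmorphM PP.
rewrite -(mulrA Z) (mulrA (D P)) DZ -(mulrA Z) -rmorphM PC rmorph0 !mulr0 addr0.
by rewrite -mulrDr -rmorphD subrK rmorph1 mulr1.
Qed.

Lemma wordZ b s : word b s * Z = Z * word b s.
Proof.
elim: s b => [|P s IH] b /=; first by rewrite mulr1 mul1r.
by rewrite -mulrA shrinkZ mulrA IH mulrA.
Qed.

Lemma word_cat b u v : word b (u ++ v) = word (b (+) odd (size u)) v * word b u.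
Proof.
elim: u b => [|P u IH] b /=; first by rewrite addbF mulr1.
by rewrite IH mulrA addbN addNb.
Qed.

(** Neighbouring letters are twisted oppositely, whence two equal ones
    contribute [shrink (1 - Q) * shrink Q] for some Q. *)
Lemma word_pair b u P v : line_proj P ->
  word b (u ++ P :: P :: v) = Z * word b (u ++ v).
Proof.
move=> lP; rewrite !word_cat /= negbK -(mulrA (word _ v)) twistN shrinkC.
  by rewrite wordZ -mulrA.
exact: line_twist.
Qed.

Lemma word_reducible b s : {in s, forall P, line_proj P} -> reducible s ->
  word b s = Z ^+ (size s)./2.
Proof.
move=> + rs; elim: rs b => [|u P v _ IH] b ls //=.
rewrite word_pair; last by apply: ls; rewrite mem_cat inE eqxx orbT.
rewrite IH; last first.
  move=> Q; rewrite mem_cat => Qin; apply: ls; rewrite mem_cat !inE.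
  by case/orP: Qin => ->; rewrite ?orbT.
by rewrite !size_cat /= !addnS /= -exprS.
Qed.

(* The constants span the space modulo t. *)
Hypothesis genZ : (1%:M <= iota + Z)%MS.

(** The inclusion from right to left holds because [P *m iota] is fixed by
    [shrink P] and because Z is a left multiple of [shrink P] by [shrinkC]. *)
Lemma shrink_eqmx P : line_proj P -> (shrink P :=: P *m iota + Z)%MS.
Proof.
move=> lP; apply/eqmxP/andP; split.
  have gen X : (D X <= iota *m D X + Z)%MS.
    rewrite -[X in (X <= _)%MS]mul1mx.
    apply: submx_trans (submxMr _ genZ) _; rewrite addsmxMr addsmxS//.
    by rewrite mulmxE -DZ -mulmxE submxMl.
  apply: addmx_sub; first by rewrite -iotaD gen.
  by rewrite -DZ -mulmxE (submx_trans (submxMl _ _))// addsmxSr.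
rewrite addsmx_sub; apply/andP; split.
  have -> : P *m iota = P *m iota *m shrink P.
    rewrite /shrink mulmxDr -mulmxA iotaD mulmxA -[P *m P]/(P * P) line_projM//.
    rewrite -DZ -mulmxE !mulmxA -(mulmxA P) iotaD mulmxA.
    rewrite -[P *m (1 - P)]/(P * (1 - P)) mulrBr mulr1 line_projM//.
    by rewrite subrr !mul0mx addr0.
  exact: submxMl.
by rewrite -{1}(shrinkC lP) -mulmxE submxMl.
Qed.

(** The constants in the line of [1 - P] generate the whole space together
    with the row space of [shrink P]. *)
Lemma mxrank_shrink P : line_proj P -> (d <= (\rank (shrink P)).+1)%N.
Proof.
move=> lP; have : (1%:M <= (1 - P) *m iota + shrink P)%MS.
  apply: submx_trans genZ _.
  rewrite (adds_eqmx (eqmx_refl _) (shrink_eqmx lP)) addsmxA addsmxS//.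
  rewrite -[X in (X <= _)%MS]mul1mx -[X in (X *m _ <= _)%MS](subrK P) mulmxDl.
  exact: addmx_sub_adds.
move/mxrankS; rewrite mxrank1 => /leq_trans; apply.
apply: leq_trans (mxrank_adds_leqif _ _).1 _.
have := mxrankM_maxl (1 - P) iota; rewrite (line_projC lP).2.
by rewrite -(leq_add2r (\rank (shrink P))).
Qed.

Lemma mxrank_shrink_mul P (G : 'M_d) : line_proj P ->
  (\rank G <= (\rank (shrink P *m G)).+1)%N.
Proof.
move=> lP; rewrite -(leq_add2l d).
apply: leq_trans (leq_add (mxrank_shrink lP) (leqnn _)) _.
rewrite addSn addnS ltnS -leq_subLR; exact: mxrank_mul_min.
Qed.

Lemma word_rcons b s P :
  word b (rcons s P) = shrink (twist (b (+) odd (size s)) P) * word b s.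
Proof. by rewrite -cats1 word_cat /= mul1r. Qed.

(** A stable complete flag indexed by codimension, so that its terms match
    the prefixes of a word. *)
Definition descending_flag (V : nat -> 'M[C]_d) : Prop :=
  [/\ forall j, (j <= d)%N -> \rank (V j) = (d - j)%N,
      forall j, (j < d)%N -> (V j.+1 <= V j)%MS
    & forall j, (j <= d)%N -> (V j *m Z <= V j)%MS].

Lemma mxrank_word b s : {in s, forall P, line_proj P} ->
  (d <= \rank (word b s) + size s)%N.
Proof.
elim/last_ind: s => [|s P IH] ls; first by rewrite mxrank1 addn0.
have lsP : line_proj P by apply: ls; rewrite mem_rcons mem_head.
apply: leq_trans (IH _) _.
  by move=> Q Qs; apply: ls; rewrite mem_rcons inE Qs orbT.
rewrite size_rcons addnS -addSn leq_add2r word_rcons.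
by apply: mxrank_shrink_mul; exact: line_twist.
Qed.

(** As d letters lower the rank from d to 0, and each lowers it by at most
    one, each lowers it by exactly one. *)
Lemma word_flag s : size s = d -> {in s, forall P, line_proj P} ->
  word false s = 0 -> descending_flag (fun j => word false (take j s)).
Proof.
move=> sd ls ws; split=> j jd.
- apply/eqP; rewrite eqn_leq; apply/andP; split; last first.
    rewrite leq_subLR addnC -[X in (_ <= _ + X)%N](_ : size (take j s) = j).
      by apply: mxrank_word => P /mem_take/ls.
    by rewrite size_takel// sd.
  have := mxrank_mul_min (word (odd j) (drop j s)) (word false (take j s)).
  have -> : word (odd j) (drop j s) *m word false (take j s) = 0.
    by rewrite -ws -[in RHS](cat_take_drop j s) word_cat size_takel ?sd.
  rewrite mxrank0 leqn0 subn_eq0.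
  have : (d <= \rank (word (odd j) (drop j s)) + (d - j))%N.
    have -> : (d - j)%N = size (drop j s) by rewrite size_drop sd.
    by apply: mxrank_word => P /mem_drop/ls.
  by move: (\rank _) (\rank _) => a g; lia.
- rewrite (take_nth 0) ?sd// word_rcons; exact: submxMl.
- rewrite -[_ *m Z]/(_ * Z) wordZ; exact: submxMl.
Qed.

Hypothesis Zn : Z ^+ n = 0.

(** Since V has codimension one in G, otherwise G = t G + V.  Iterating gives
    G = t^k G + V for all k, and nilpotency yields G = V, a contradiction. *)
Lemma Z_stable_corank1 (G V : 'M_d) : G * Z = Z * G -> (V <= G)%MS ->
  (V *m Z <= V)%MS -> \rank G = (\rank V).+1 -> (Z *m G <= V)%MS.
Proof.
move=> GZ VG VZ rG.
have GZV : (G *m Z + V <= G)%MS by rewrite addsmx_sub VG mulmxE GZ -mulmxE submxMl.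
have [h|h] := boolP (G <= G *m Z + V)%MS; last first.
  have : (G *m Z + V <= V)%MS.
    have [_] := mxrank_leqif_sup (addsmxSr (G *m Z)%MS V); move=> <-.
    rewrite eqn_leq mxrankS ?addsmxSr//= -ltnS -rG ltn_neqAle mxrankS// andbT.
    by have [_ ->] := mxrank_leqif_sup GZV.
  by rewrite addsmx_sub => /andP[+ _]; rewrite mulmxE GZ.
have hk k : (G <= G *m Z ^+ k + V)%MS.
  elim: k => [|k IH]; first by rewrite mulmx1 addsmxSl.
  apply: submx_trans IH _; rewrite addsmx_sub addsmxSr andbT exprSr -mulmxE mulmxA.
  have : (G *m Z ^+ k <= (G *m Z + V)%MS *m Z ^+ k)%MS by apply: submxMr.
  move/submx_trans; apply; rewrite addsmxMr addsmx_sub; apply/andP; split.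
    rewrite -!mulmxA -[Z *m Z ^+ k]/(Z * Z ^+ k) -[Z ^+ k *m Z]/(Z ^+ k * Z).
    by rewrite -exprS -exprSr addsmxSl.
  apply: submx_trans (addsmxSr _ _); elim: k => [|k IH]; first by rewrite mulmx1.
  by rewrite exprSr -mulmxE mulmxA (submx_trans (submxMr _ IH)).
have := hk n; rewrite Zn mulmx0 adds0mx => /mxrankS; rewrite rG.
by rewrite ltnn.
Qed.

Lemma mxrank_kernel_quotient (G V q : 'M[C]_d) :
  (forall m (u : 'M_(m, d)), (u *m q == 0) = (u <= V)%MS) -> (V <= G)%MS ->
  \rank G = (\rank (G *m q) + \rank V)%N.
Proof.
move=> qV VG; rewrite -(mxrank_mul_ker G q); congr (_ + _)%N.
apply: eqmx_rank; apply/andP; split.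
  by rewrite -qV; apply/eqP/sub_kermxP; exact: capmxSr.
by rewrite sub_capmx VG; apply/sub_kermxP/eqP; rewrite qV.
Qed.

(** One step down a flag: G is the word read so far and V the next term.  The
    matrix q stands for the quotient map by V, so that K is the map from the
    constants C^2 to G / V.  Its kernel is the next line. *)
Section Step.
Variables (G V q : 'M[C]_d).
Hypotheses (GZ : G * Z = Z * G)
  (qV : forall m (u : 'M_(m, d)), (u *m q == 0) = (u <= V)%MS)
  (VG : (V <= G)%MS) (VZ : (V *m Z <= V)%MS) (rG : \rank G = (\rank V).+1).

Let K := iota *m G *m q.

(** By [Z_stable_corank1] the line G / V receives nothing from t E, and so it
    is the image of the constants. *)
Lemma mxrank_step : \rank K = 1%N.
Proof.
have r1 : \rank (G *m q) = 1%N.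
  have /eqP := mxrank_kernel_quotient qV VG.
  by rewrite rG -add1n eqn_add2r => /eqP.
apply/eqP; rewrite eqn_leq; apply/andP; split.
  by apply: leq_trans (eq_leq r1); rewrite /K -mulmxA mxrankM_maxr.
rewrite lt0n mxrank_eq0; apply/eqP => K0.
have : (1%:M *m (G *m q) <= (iota + Z)%MS *m (G *m q))%MS by apply: submxMr.
rewrite mul1mx addsmxMr mulmxA -/K K0 adds0mx.
have /eqP -> : Z *m (G *m q) == 0 by rewrite mulmxA qV Z_stable_corank1.
by move/mxrankS; rewrite r1 mxrank0.
Qed.

Lemma step_kernel P : line_proj P ->
  ((shrink P *m G :=: V)%MS <-> P *m K = 0).
Proof.
move=> lP.
have ZG : (Z *m G <= V)%MS by apply: Z_stable_corank1.
split=> [sV|PK].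
  apply/eqP; rewrite /K !mulmxA qV -sV.
  by rewrite -mulmxA mulmxA submxMr// shrink_eqmx// addsmxSl.
have sV : (shrink P *m G <= V)%MS.
  have : (shrink P *m G <= (P *m iota + Z)%MS *m G)%MS by rewrite submxMr// shrink_eqmx.
  move/submx_trans; apply; rewrite addsmxMr addsmx_sub ZG andbT -qV.
  by rewrite -!mulmxA; move: PK; rewrite /K -!mulmxA => ->.
apply/eqmxP; rewrite -(mxrank_leqif_eq sV) eqn_leq mxrankS//=.
by rewrite -ltnS -rG mxrank_shrink_mul.
Qed.

Lemma line_kernel P : line_proj P -> P *m K = 0 -> (P :=: kermx K)%MS.
Proof.
move=> lP PK; apply/eqmxP.
have PK' : (P <= kermx K)%MS by apply/sub_kermxP.
by rewrite -(mxrank_leqif_eq PK') lP.2 mxrank_ker mxrank_step.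
Qed.

Lemma step_exists : exists2 P, line_proj P & (shrink P *m G :=: V)%MS.
Proof.
have lP : line_proj (proj_ortho (kermx K)).
  by apply: line_proj_of; rewrite mxrank_ker mxrank_step.
exists (proj_ortho (kermx K)) => //; apply/step_kernel => //.
by apply/sub_kermxP; rewrite proj_orthoE.
Qed.

(** The alternating form of C^2. *)
Definition rot2 : 'M[C]_2 := \matrix_(i, j) (j%:R - i%:R).

Lemma rot2_alt (a : 'cV[C]_2) : a^T *m rot2 *m a = 0.
Proof.
apply/matrixP => i j; rewrite !ord1 {i j} !mxE !big_ord_recl big_ord0 !mxE.
rewrite !big_ord_recl !big_ord0 !mxE /= !(subrr, addr0, mulr0, add0r, subr0, sub0r).
by rewrite mulr1 mulrN1 mulNr addrC mulrC subrr.
Qed.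

Lemma rot2_unit : rot2 \in unitmx.
Proof.
have /mulmx1_unit[] // : rot2 *m - rot2 = 1%:M.
apply/matrixP => i j; rewrite !mxE !big_ord_recl big_ord0 !mxE.
case: i j => [[|[|i]]] hi [[|[|j]]] hj //=;
  by rewrite !(subrr, addr0, mulr0, add0r, subr0, sub0r, mulr1, mulrN1, opprK, oppr0).
Qed.

(** Writing K = a b with a column a, the kernel of K is the orthogonal of a for
    the alternating form, and this is spanned by the rows of [K^T *m rot2].  The
    point is that this matrix is polynomial in K. *)
Lemma step_formula P : line_proj P -> (shrink P *m G :=: V)%MS -> (P :=: K^T *m rot2)%MS.
Proof.
move=> lP /(step_kernel lP)/(line_kernel lP) eP; apply: eqmx_trans eP _.
have /sub_kermxP sK : K^T *m rot2 *m K = 0.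
  move: (col_base K) (row_base K) (mulmx_base K); rewrite mxrank_step => a b <-.
  rewrite trmx_mul -!mulmxA (mulmxA rot2) (mulmxA a^T) (mulmxA a^T rot2).
  by rewrite rot2_alt mul0mx mulmx0.
apply/eqmx_sym/eqmxP; rewrite -(mxrank_leqif_eq sK).
rewrite mxrankMfree ?row_free_unit ?rot2_unit//.
by rewrite mxrank_tr mxrank_ker mxrank_step.
Qed.
End Step.

(** The complementary projector of V serves as quotient map by V because it
    depends continuously on V. *)
Definition next_line (G V : 'M[C]_d) : 'M[C]_2 :=
  proj_ortho ((iota *m G *m (1%:M - proj_ortho V))^T *m rot2).

Lemma proj_ortho_ker m (u : 'M[C]_(m, d)) p (V : 'M[C]_(p, d)) :
  (u *m (1%:M - proj_ortho V) == 0) = (u <= V)%MS.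
Proof.
rewrite mulmxBr mulmx1 subr_eq0; apply/eqP/idP => [->|]; first exact: proj_ortho_sub.
by move=> uV; rewrite proj_ortho_id.
Qed.

(** The letters are found one after the other by [step_exists]. *)
Lemma exists_word V : descending_flag V -> exists s,
  [/\ size s = d, {in s, forall P, line_proj P}
    & forall j, (j <= d)%N -> (word false (take j s) :=: V j)%MS].
Proof.
move=> [rV dV sV]; suff: forall k, (k <= d)%N -> exists s,
  [/\ size s = k, {in s, forall P, line_proj P}
    & forall j, (j <= k)%N -> (word false (take j s) :=: V j)%MS] by apply.
elim=> [|k IH] kd.
  exists [::]; split=> // j; rewrite leqn0 => /eqP->.
  apply/eqmx_sym/eqmxP; rewrite -(mxrank_leqif_eq (submx1 _)) rV//.
  by rewrite mxrank1 subn0.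
have [s [sk ls ws]] := IH (ltnW kd).
have GV : (word false s :=: V k)%MS by rewrite -{1}(take_size s) sk; apply: ws.
have [|||||P lP PV] := @step_exists (word false s) (V k.+1) (1%:M - proj_ortho (V k.+1)).
- exact: wordZ.
- by move=> m u; exact: proj_ortho_ker.
- by rewrite GV dV.
- exact: sV.
- by rewrite GV !rV ?(ltnW kd)// subnSK.
exists (rcons s (twist (odd k) P)); split.
- by rewrite size_rcons sk.
- by move=> Q; rewrite mem_rcons inE => /orP[/eqP->|/ls//]; exact: line_twist.
move=> j; rewrite leq_eqVlt => /orP[/eqP->|jk].
  by rewrite take_oversize ?size_rcons ?sk// word_rcons sk /= twistK.
by rewrite -cats1 takel_cat ?sk//; exact: ws.
Qed.

Lemma word_next_line V s j : descending_flag V -> size s = d ->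
  {in s, forall P, line_proj P} ->
  (forall j, (j <= d)%N -> (word false (take j s) :=: V j)%MS) -> (j < d)%N ->
  s`_j = twist (odd j) (next_line (word false (take j s)) (V j.+1)).
Proof.
move=> [rV dV sV] sd ls ws jd; apply: (canRL (twistK _)).
have lj : line_proj (twist (odd j) s`_j) by apply/line_twist/ls/mem_nth; rewrite sd.
have PV : (shrink (twist (odd j) s`_j) *m word false (take j s) :=: V j.+1)%MS.
  by have := ws j.+1 jd; rewrite (take_nth 0) ?sd// word_rcons /= size_take sd jd.
rewrite -[LHS]lj.1; apply: eq_proj_ortho; apply: step_formula PV => //.
- exact: wordZ.
- by move=> m u; exact: proj_ortho_ker.
- by rewrite (ws _ (ltnW jd)) dV.
- exact: sV.
- by rewrite (ws _ (ltnW jd)) !rV ?(ltnW jd)// subnSK.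
Qed.

Hypothesis freeZ : row_free (iota *m Z ^+ n').

(** The word modulo t. *)
Fixpoint proj_word b s : 'M[C]_2 :=
  if s is P :: s' then proj_word (~~ b) s' * twist b P else 1.

(** Modulo t, [shrink P] is D P; and t^(n-1) annihilates the multiples of t. *)
Lemma word_mod b s : Z ^+ n' * word b s = Z ^+ n' * D (proj_word b s).
Proof.
elim: s b => [|P s IH] b /=; first by rewrite rmorph1.
rewrite mulrA IH -mulrA rmorphM /shrink mulrDr mulrDr (mulrA _ Z) DZ.
by rewrite -(mulrA Z) (mulrA _ Z) -exprSr Zn mul0r addr0.
Qed.

(** If no two consecutive projectors are orthogonal, each factor maps the line
    that is the row space of the product of the previous ones isomorphically
    onto another line. *)
Lemma proj_word_eq0 b s : {in s, forall P, line_proj P} -> proj_word b s = 0 ->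
  exists u P v, s = u ++ P :: P :: v.
Proof.
elim: s b => [|P [|Q s] IH] b ls /=.
- by move/eqP; rewrite oner_eq0.
- rewrite mul1r => /eqP; rewrite (negbTE (line_projN0 (line_twist b _)))//.
  by apply: ls; rewrite mem_head.
have lP : line_proj P by apply: ls; rewrite mem_head.
have lQ : line_proj Q by apply: ls; rewrite !inE eqxx orbT.
have [QP0 _|QP0] := eqVneq (twist (~~ b) Q * twist b P) 0.
  exists [::], P, s; suff -> : Q = P by [].
  have := line_proj_mul0 (line_twist _ lQ) (line_twist _ lP) QP0.
  by rewrite -twistN => /(congr1 (twist (~~ b))); rewrite !twistK.
rewrite negbK -mulrA => AQP.
have : proj_word (~~ b) (Q :: s) = 0.
  rewrite /= negbK; apply/eqP; rewrite -[_ == 0]negbK; apply/negP => A0.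
  move/eqP: QP0; apply; apply/eqP; rewrite -submx0 -AQP -!mulmxE mulmxA.
  apply: submxMr; have lQ' := line_twist (~~ b) lQ.
  suff : (proj_word b s *m twist (~~ b) Q == twist (~~ b) Q)%MS by case/andP.
  rewrite -(mxrank_leqif_eq (submxMl _ _)) eqn_leq mxrankM_maxr /=.
  by rewrite lQ'.2 lt0n mxrank_eq0.
case/IH => [R Rin|u [R [v ->]]]; first by apply: ls; rewrite inE Rin orbT.
by exists (P :: u), R, v.
Qed.

(** The word vanishes modulo t, so that by [proj_word_eq0] two neighbouring
    letters cancel against a factor t.  The exponent n - m counts the factors
    that have been removed. *)
Lemma reducible_word m b s : size s = m.*2 -> (m <= n)%N ->
  {in s, forall P, line_proj P} -> Z ^+ (n - m) * word b s = 0 -> reducible s.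
Proof.
elim: m b s => [|m IH] b s sz mn ls W0.
  by rewrite (size0nil sz); exact: reducible_nil.
have : proj_word b s = 0.
  have : Z ^+ n' * word b s = 0.
    have -> : Z ^+ n' = Z ^+ m * Z ^+ (n - m.+1) by rewrite -exprD subSS subnKC.
    by rewrite -mulrA W0 mulr0.
  rewrite word_mod => /(congr1 (mulmx iota)); rewrite -mulmxE mulmx0.
  have -> : Z ^+ n' *m D (proj_word b s) = D (proj_word b s) *m Z ^+ n'.
    by rewrite mulmxE; apply/esym/commrX; exact: DZ.
  rewrite mulmxA iotaD -mulmxA => /eqP.
  by rewrite mulmx_free_eq0// => /eqP.
move=> /(proj_word_eq0 ls)[u [P [v sE]]]; rewrite sE; apply: reducible_pair.
have lP : line_proj P by apply: ls; rewrite sE mem_cat mem_head orbT.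
apply: (IH b).
- by move: sz; rewrite sE !size_cat /= !addnS doubleS => -[].
- exact: ltnW.
- move=> Q; rewrite mem_cat => Qin; apply: ls; rewrite sE mem_cat !inE.
  by case/orP: Qin => ->; rewrite ?orbT.
by move: W0; rewrite sE word_pair// mulrA -exprSr subnSK.
Qed.
End Words.

(** * Two Jordan blocks of equal size *)

Section TwoBlocks.
Context {F : fieldType} {n' : nat}.
Local Notation n := n'.+1.

Definition shift_mx : 'M[F]_n := \matrix_(i, j) (i == j.+1 :> nat)%:R.

(** Multiplication by t in the basis t^(n-1), ..., t, 1 of each chain. *)
Definition two_shifts : 'M[F]_(n + n) := block_mx shift_mx 0 0 shift_mx.

(** Q tensor the identity of C[t]/t^n. *)
Definition amplify (Q : 'M[F]_2) : 'M[F]_(n + n) :=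
  block_mx (Q 0 0)%:M (Q 0 1)%:M (Q 1 0)%:M (Q 1 1)%:M.

(** The vectors 1 of the two chains. *)
Definition chain_tops : 'M[F]_(2, n + n) :=
  row_mx (delta_mx 0 ord_max) (delta_mx 1 ord_max).

Lemma sum_ord2 (V : nmodType) (f : 'I_2 -> V) : \sum_i f i = f 0 + f 1.
Proof. by rewrite !big_ord_recl big_ord0 addr0; congr (f _ + f _); apply: val_inj. Qed.

Lemma amplify_is_additive : zmod_morphism amplify.
Proof.
by move=> P Q; rewrite /amplify opp_block_mx add_block_mx !mxE !raddfB.
Qed.

Lemma amplify_is_multiplicative : monoid_morphism amplify.
Proof.
split=> [|P Q].
  by rewrite /amplify !mxE /= mulr0n raddf0 -scalar_mx_block.
rewrite -[RHS]/(amplify P *m amplify Q) -[P * Q]/(P *m Q) /amplify.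
rewrite mulmx_block !mxE !sum_ord2.
by rewrite -!scalar_mxM -!raddfD.
Qed.

HB.instance Definition _ :=
  GRing.isZmodMorphism.Build _ _ amplify amplify_is_additive.
HB.instance Definition _ :=
  GRing.isMonoidMorphism.Build _ _ amplify amplify_is_multiplicative.

Lemma amplify_shifts Q : amplify Q * two_shifts = two_shifts * amplify Q.
Proof.
rewrite -!mulmxE /amplify /two_shifts !mulmx_block !mul0mx !mulmx0 !addr0 !add0r.
by rewrite !(scalar_mxC _ shift_mx).
Qed.

Lemma chain_tops_amplify Q : chain_tops *m amplify Q = Q *m chain_tops.
Proof.
rewrite /chain_tops /amplify mul_row_block mul_mx_row !mul_mx_scalar.
have ord2 (i : 'I_2) : i = 0 \/ i = 1.
  by case: i => [[|[|//]] hi]; [left|right]; apply: val_inj.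
by congr row_mx; apply/matrixP => i j; rewrite !mxE !sum_ord2 !mxE;
  case: (ord2 i) => -> /=; rewrite !(mulr0, addr0, add0r).
Qed.

Lemma shift_mxX k : shift_mx ^+ k = \matrix_(i, j) (i == j + k :> nat)%N%:R.
Proof.
elim: k => [|k IH]; first by apply/matrixP => i j; rewrite !mxE addn0.
apply/matrixP => i j; rewrite exprS IH -mulmxE !mxE.
case: i => [[|i] hi] /=.
  by rewrite big1 ?addnS// => l _; rewrite !mxE /= mul0r.
have hi' : (i < n)%N by exact: ltnW.
rewrite (bigD1 (Ordinal hi')) //= big1 ?addr0 => [|l li].
  by rewrite !mxE /= eqxx mul1r addnS eqSS.
rewrite !mxE /= eqSS eq_sym; have := li; rewrite -(inj_eq val_inj) /=.
by move=> /negbTE->; rewrite mul0r.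
Qed.

Lemma two_shiftsX k : two_shifts ^+ k = block_mx (shift_mx ^+ k) 0 0 (shift_mx ^+ k).
Proof.
elim: k => [|k IH]; first by rewrite !expr0; exact: scalar_mx_block.
by rewrite !exprS IH -mulmxE mulmx_block !mul0mx !mulmx0 !addr0 !add0r.
Qed.

Lemma two_shifts_nilpotent : two_shifts ^+ n = 0.
Proof.
rewrite two_shiftsX shift_mxX (_ : \matrix_(i, j) _ = 0) ?block_mx0//.
apply/matrixP => i j; rewrite !mxE (_ : (i == _ :> nat) = false)//.
by have := ltn_ord i; lia.
Qed.

Lemma chain_tops_free : row_free (chain_tops *m two_shifts ^+ n').
Proof.
rewrite two_shiftsX /chain_tops mul_row_block !mulmx0 addr0 add0r.
have e (k : 'I_2) : delta_mx k ord_max *m shift_mx ^+ n' = delta_mx k 0.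
  rewrite -(mul_delta_mx (0 : 'I_1) k ord_max) -mulmxA -rowE.
  suff -> : row ord_max (shift_mx ^+ n') = delta_mx 0 0 by rewrite mul_delta_mx.
  apply/rowP => j; rewrite shift_mxX !mxE eqxx /= -(inj_eq val_inj) /=.
  by congr (nat_of_bool _)%:R; lia.
rewrite !e; apply/row_freeP; exists (col_mx (delta_mx 0 0) (delta_mx 0 1)).
rewrite mul_row_col !mul_delta_mx; apply/matrixP => i j; rewrite !mxE.
by case: i j => [[|[|i]] hi] [[|[|j]] hj]//=; rewrite ?addr0 ?add0r.
Qed.

Lemma chain_tops_generate : (1%:M <= chain_tops + two_shifts)%MS.
Proof.
apply/row_subP => i.
suff [[k ->]|[k ->]] : (exists k, row i 1%:M = row k chain_tops) \/
    (exists k, row i 1%:M = row k two_shifts).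
- by apply: submx_trans (addsmxSl _ _); exact: row_sub.
- by apply: submx_trans (addsmxSr _ _); exact: row_sub.
have row_shift (i0 : 'I_n) (hi : (i0 < n')%N) :
    row (lift ord0 (Ordinal hi)) shift_mx = row i0 1%:M.
  apply/rowP => j; rewrite !mxE /= -[RHS]/((i0 == j)%:R) -(inj_eq val_inj) /=.
  by congr (nat_of_bool _)%:R; lia.
have row_delta k (i0 : 'I_n) : (n' <= i0)%N ->
    row k (delta_mx k ord_max : 'M[F]_(2, n)) = row i0 1%:M.
  move=> hi; apply/rowP => j; rewrite !mxE eqxx /= -!(inj_eq val_inj) /=.
  by congr (nat_of_bool _)%:R; have := ltn_ord j; have := ltn_ord i0; lia.
have row_delta0 k l : k != l -> row k (delta_mx l ord_max : 'M[F]_(2, n)) = 0.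
  by move=> kl; apply/rowP => j; rewrite !mxE (negbTE kl).
rewrite scalar_mx_block /two_shifts /chain_tops /block_mx.
rewrite -(splitK i); case: (fintype.split i) => {}i /=.
  rewrite rowKu row_row_mx row0; have [hi|hi] := ltnP i n'; [right|left].
    exists (lshift n (lift ord0 (Ordinal hi))).
    by rewrite rowKu row_row_mx row0 row_shift.
  by exists 0; rewrite row_row_mx (row_delta _ i)// row_delta0.
rewrite rowKd row_row_mx row0; have [hi|hi] := ltnP i n'; [right|left].
  exists (rshift n (lift ord0 (Ordinal hi))).
  by rewrite rowKd row_row_mx row0 row_shift.
by exists 1; rewrite row_row_mx (row_delta _ i)// row_delta0.
Qed.

Lemma two_shiftsE (i j : 'I_(n + n)) :
  two_shifts i j = ((i == j.+1 :> nat) && (i != n :> nat))%:R.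
Proof.
rewrite /two_shifts /block_mx mxE.
case: splitP => k ik; rewrite mxE; case: splitP => l jl; rewrite mxE ik jl.
- by congr (nat_of_bool _)%:R; have := ltn_ord k; lia.
- by rewrite (_ : _ && _ = false)//; have := ltn_ord k; lia.
- by rewrite (_ : _ && _ = false)//; have := ltn_ord l; lia.
- by congr (nat_of_bool _)%:R; have := ltn_ord k; have := ltn_ord l; lia.
Qed.
End TwoBlocks.

(** * Subspaces in coordinates *)

Section RowSpace.
Context {C : fieldType} {E : vectType C}.
Local Notation d := (\dim {:E}).
Local Notation vb := (vbasis {:E}).
Let vb_basis : basis_of {:E} vb := vbasisP _.

(** The coordinates are those with respect to [vbasis], which enter the
    definition of the topology of [{vspace E}]. *)
Definition row_space m (A : 'M[C]_(m, d)) : {vspace E} := vsof vb <<A>>%MS.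

Lemma mem_row_space m (A : 'M[C]_(m, d)) v :
  (v \in row_space A) = (rVof vb v <= A)%MS.
Proof. by rewrite /row_space -rVof_sub// genmxE. Qed.

Lemma eq_row_space m p (A : 'M[C]_(m, d)) (B : 'M_(p, d)) :
  (A :=: B)%MS -> row_space A = row_space B.
Proof. by move=> AB; rewrite /row_space; congr (vsof _ _); apply/eq_genmx. Qed.

Lemma msof_row_space m (A : 'M[C]_(m, d)) : (msof vb (row_space A) :=: A)%MS.
Proof. exact: eqmx_trans (eqmxP (vsofK vb_basis _)) (genmxE A). Qed.

Lemma row_space_msof V : row_space (msof vb V) = V.
Proof. by apply/vspaceP => v; rewrite mem_row_space -mem_vecof// rVofK. Qed.

Lemma dim_row_space m (A : 'M[C]_(m, d)) : \dim (row_space A) = \rank A.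
Proof.
set V := row_space A.
pose B : 'M_(\dim V, d) := \matrix_i rVof vb (vbasis V)`_i.
have BA : (B :=: A)%MS.
  apply/eqmxP/andP; split.
    apply/row_subP => i; rewrite rowK -mem_row_space -/V.
    by apply: (vbasis_mem (U := V)); rewrite mem_nth ?size_tuple.
  have VB : (V <= row_space B)%VS.
    rewrite -[X in (X <= _)%VS](span_basis (vbasisP V)).
    apply/span_subvP => _ /tnthP[i ->]; rewrite mem_row_space.
    by apply: submx_trans (row_sub i _); rewrite rowK (tnth_nth 0).
  apply/row_subP => i; have : vecof vb (row i A) \in V.
    by rewrite mem_row_space vecofK// row_sub.
  by move/(subvP VB); rewrite mem_row_space vecofK.
rewrite -BA; apply/esym/eqP; rewrite -/(row_free B) -kermx_eq0.
apply/eqP/row_matrixP => i; rewrite row0; set u := row i _.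
have : u *m B = 0 by rewrite -row_mul mulmx_ker row0.
have -> : u *m B = rVof vb (\sum_j u 0 j *: (vbasis V)`_j).
  rewrite mulmx_sum_row raddf_sum /=; apply: eq_bigr => j _.
  by rewrite rowK linearZ.
move/eqP; rewrite rVof_eq0// => /eqP u0.
have /freeP/(_ (fun j => u 0 j) u0) := basis_free (vbasisP V).
by move=> uj; apply/rowP => j; rewrite uj mxE.
Qed.
End RowSpace.

Section ChangeOfBasis.
Context {F : fieldType} {E : vectType F}.
Local Notation vb := (vbasis {:E}).

Definition coord_row k (b : k.-tuple E) (v : E) : 'rV[F]_k := \row_j coord b j v.

Definition basis_change k l (b : k.-tuple E) (c : l.-tuple E) : 'M[F]_(k, l) :=
  \matrix_(i, j) coord c j b`_i.

Definition coord_mx k (b : k.-tuple E) (z : 'End(E)) : 'M[F]_k :=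
  \matrix_(i, j) coord b j (z b`_i).

Lemma coord_row_mul k l (b : k.-tuple E) (c : l.-tuple E) v : basis_of {:E} b ->
  coord_row b v *m basis_change b c = coord_row c v.
Proof.
move=> hb; apply/rowP => j; rewrite !mxE [in RHS](coord_basis hb (memvf v)) linear_sum.
by apply: eq_bigr => i _; rewrite !mxE linearZ.
Qed.

Lemma coord_row_app k (b : k.-tuple E) (z : 'End(E)) v : basis_of {:E} b ->
  coord_row b (z v) = coord_row b v *m coord_mx b z.
Proof.
move=> hb; apply/rowP => j; rewrite !mxE [in LHS](coord_basis hb (memvf v)) !linear_sum.
by apply: eq_bigr => i _; rewrite !mxE !linearZ.
Qed.

Lemma coord_row_surj k (b : k.-tuple E) u : basis_of {:E} b ->
  exists v, coord_row b v = u.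
Proof.
move=> hb; exists (\sum_i u 0 i *: b`_i); apply/rowP => j; rewrite mxE.
by rewrite coord_sum_free ?(basis_free hb).
Qed.

Lemma basis_changeK k l (b : k.-tuple E) (c : l.-tuple E) :
  basis_of {:E} b -> basis_of {:E} c -> basis_change b c *m basis_change c b = 1%:M.
Proof.
move=> hb hc; apply/row_matrixP => i; rewrite row_mul.
have -> : row i (basis_change b c) = coord_row c b`_i by apply/rowP => j; rewrite !mxE.
by rewrite coord_row_mul//; apply/rowP => j; rewrite !mxE coord_free ?(basis_free hb).
Qed.

Lemma coord_row_vbasis v : coord_row vb v = rVof vb v.
Proof. by []. Qed.

Definition span_of k (b : k.-tuple E) m (A : 'M[F]_(m, k)) : {vspace E} :=
  row_space (A *m basis_change b vb).

Section Basis.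
Context {k : nat} (b : k.-tuple E).
Hypothesis hb : basis_of {:E} b.
Let hvb : basis_of {:E} vb := vbasisP _.
Let vbK : basis_change vb b *m basis_change b vb = 1%:M := basis_changeK hvb hb.
Let bvK : basis_change b vb *m basis_change vb b = 1%:M := basis_changeK hb hvb.

Lemma vbasis_change_free : row_free (basis_change vb b).
Proof. by apply/row_freeP; exists (basis_change b vb). Qed.

Lemma basis_change_free : row_free (basis_change b vb).
Proof. by apply/row_freeP; exists (basis_change vb b). Qed.

Lemma mem_span_of m (A : 'M[F]_(m, k)) v : (v \in span_of b A) = (coord_row b v <= A)%MS.
Proof.
rewrite mem_row_space -coord_row_vbasis -(coord_row_mul _ v hb).
by rewrite submxMfree ?basis_change_free.
Qed.

Lemma eq_span_of m p (A : 'M[F]_(m, k)) (B : 'M_(p, k)) :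
  (A :=: B)%MS -> span_of b A = span_of b B.
Proof. by move=> AB; apply: eq_row_space; apply: eqmxMr. Qed.

Lemma dim_span_of m (A : 'M[F]_(m, k)) : \dim (span_of b A) = \rank A.
Proof. by rewrite /span_of dim_row_space mxrankMfree ?basis_change_free. Qed.

Lemma sub_span_of m p (A : 'M[F]_(m, k)) (B : 'M_(p, k)) :
  (span_of b A <= span_of b B)%VS = (A <= B)%MS.
Proof.
apply/subvP/idP => [h|AB v]; last by rewrite !mem_span_of => /submx_trans; exact.
apply/row_subP => i; have [v vi] := coord_row_surj (row i A) hb.
by rewrite -vi -mem_span_of; apply: h; rewrite mem_span_of vi row_sub.
Qed.

Lemma stable_span_of m (A : 'M[F]_(m, k)) (z : 'End(E)) :
  (z @: span_of b A <= span_of b A)%VS = (A *m coord_mx b z <= A)%MS.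
Proof.
apply/subvP/idP => [h|AZ _ /memv_imgP[v vA ->]].
  apply/row_subP => i; have [v vi] := coord_row_surj (row i A) hb.
  rewrite row_mul -vi -coord_row_app// -mem_span_of; apply: h; apply: memv_img.
  by rewrite mem_span_of vi row_sub.
rewrite mem_span_of coord_row_app//; move: vA; rewrite mem_span_of => vA.
exact: submx_trans (submxMr _ vA) AZ.
Qed.
End Basis.
End ChangeOfBasis.

Lemma coord_mx_Jordan (F : fieldType) (E : vectType F) n' (z : 'End(E))
    (e f : n'.+1.-tuple E) :
  basis_of {:E} (e ++ f) ->
  (forall i, (i < n'.+1)%N -> z e`_i = if i is i'.+1 then e`_i' else 0) ->
  (forall i, (i < n'.+1)%N -> z f`_i = if i is i'.+1 then f`_i' else 0) ->
  coord_mx (cat_tuple e f) z = two_shifts.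
Proof.
move=> hb ze zf; apply/matrixP => i j; rewrite two_shiftsE mxE.
(* Each basis vector goes to its predecessor, except those with index 0 and n,
   with which the two chains start. *)
have zb : z (cat_tuple e f)`_i = if nat_of_ord i is i'.+1 then
    (if i' == n' then 0 else (cat_tuple e f)`_i') else 0.
  rewrite /= nth_cat size_tuple; have [hi|hi] := ltnP i n'.+1.
    rewrite ze//; case: (nat_of_ord i) hi => // i' hi.
    by rewrite nth_cat size_tuple ltnW// ltn_eqF.
  rewrite zf; last by have := ltn_ord i; lia.
  case: (nat_of_ord i) hi => // i' hi; rewrite nth_cat size_tuple.
  have [->|ne] := eqVneq i' n'; first by rewrite subnn.
  rewrite subSS ltnNge (_ : (n'.+1 <= i')%N) /=; last by lia.
  by rewrite (_ : (i' - n')%N = (i' - n'.+1).+1)//; lia.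
rewrite zb; case: i {zb} => [[|i] hi] /=; first by rewrite linear0.
have [->|ne] := eqVneq i n'; first by rewrite linear0 eqxx andbF.
have hi' : (i < n'.+1 + n'.+1)%N by lia.
rewrite -[i in _`_i]/(nat_of_ord (Ordinal hi')) coord_free ?(basis_free hb)//.
by rewrite -(inj_eq val_inj) /= !eqSS ne andbT eq_sym.
Qed.

(** * Continuity of matrix operations *)

Local Open Scope complex_scope.
Local Open Scope classical_set_scope.

Lemma continuous_mx (X T : topologicalType) m n (f : X -> 'M[T]_(m, n)) :
  (forall i j, continuous (fun x => f x i j)) -> continuous f.
Proof.
move=> cf x A [P MP PA].
have : \forall y \near x, forall ij : 'I_m * 'I_n, P ij.1 ij.2 (f y ij.1 ij.2).
  by apply: filter_forall => ij; apply: cf; exact: MP.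
by apply: filterS => y Py; apply: PA => i j; exact: (Py (i, j)).
Qed.

Lemma continuous_coord (X T : topologicalType) m n (f : X -> 'M[T]_(m, n)) i j :
  continuous f -> continuous (fun x => f x i j).
Proof.
move=> cf x; apply: (@continuous_comp _ _ _ f (fun M : 'M[T]_(m, n) => M i j)).
  exact: cf.
move=> A MA; exists (fun i' j' => [set t | i' = i -> j' = j -> A t]).
  move=> i' j' /=; have [[-> ->]|ne] := pselect (i' = i /\ j' = j).
    rewrite (_ : mkset _ = A); first exact: MA.
    by apply/seteqP; split=> t //=; apply.
  by apply: filterE => t ei ej; case: ne.
by move=> N; apply.
Qed.

Section ScalarContinuity.
Context {R : realType} {X : topologicalType}.
Let K : numFieldType := R[i].

(** The norm topology of the complex numbers agrees with their topology as a
    numeric field, for which the field operations are known to be continuous. *)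
Lemma continuousE (f : X -> R[i]) : continuous f <-> continuous (f : X -> K).
Proof. by split=> cf x A; exact: cf. Qed.

Lemma continuous_addc (f g : X -> R[i]) :
  continuous f -> continuous g -> continuous (fun x => f x + g x).
Proof.
move=> /continuousE cf /continuousE cg; apply/continuousE => x.
exact: (@cvgD K K _ _ _ (f : X -> K) (g : X -> K) _ _ (cf x) (cg x)).
Qed.

Lemma continuous_mulc (f g : X -> R[i]) :
  continuous f -> continuous g -> continuous (fun x => f x * g x).
Proof.
move=> /continuousE cf /continuousE cg; apply/continuousE => x.
exact: (@cvgM K _ _ _ (f : X -> K) (g : X -> K) _ _ (cf x) (cg x)).
Qed.

Lemma continuous_oppc (f : X -> R[i]) : continuous f -> continuous (fun x => - f x).
Proof.
move=> /continuousE cf; apply/continuousE => x.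
exact: (@cvgN K K _ _ _ (f : X -> K) _ (cf x)).
Qed.

Lemma continuous_invc (f : X -> R[i]) : (forall x, f x != 0) ->
  continuous f -> continuous (fun x => (f x)^-1).
Proof.
move=> f0 /continuousE cf; apply/continuousE => x.
exact: (@cvgV K _ _ _ (f : X -> K) _ (f0 x) (cf x)).
Qed.

Lemma continuous_conjc (f : X -> R[i]) :
  continuous f -> continuous (fun x => Num.Def.conjC (f x)).
Proof.
move=> /continuousE cf; apply/continuousE => x; apply/(@cvgrPdist_lt K K) => e e0.
have /(@cvgrPdist_lt K K) /(_ e e0) := cf x; apply: filterS => y.
by rewrite -rmorphB norm_conjC.
Qed.

Lemma continuous_cst (Y : topologicalType) (c : Y) : continuous (fun _ : X => c).
Proof. by move=> x; exact: cvg_cst. Qed.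

Lemma near_neq0 (f : X -> R[i]) x :
  continuous f -> f x != 0 -> \forall y \near x, f y != 0.
Proof.
move=> /continuousE cf fx0.
have fn0 := @cvgr_neq0 K K _ _ _ (f : X -> K) _ (cf x) fx0; exact: fn0.
Qed.
End ScalarContinuity.

Section ComplexMatrixContinuity.
Context {R : realType} {X : topologicalType}.
Local Notation C := R[i].

Lemma continuous_sum (I : Type) (r : seq I) (P : pred I) (F : I -> X -> C) :
  (forall i, continuous (F i)) -> continuous (fun x => \sum_(i <- r | P i) F i x).
Proof.
move=> cF; elim: r => [|i r IH].
  rewrite (_ : (fun _ => _) = fun=> 0); first exact: continuous_cst.
  by apply/funext => y; rewrite big_nil.
rewrite (_ : (fun _ => _) =
    fun y => (if P i then F i y else 0) + \sum_(i <- r | P i) F i y).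
  by apply: (continuous_addc _ IH); case: (P i); [exact: cF|exact: continuous_cst].
by apply/funext => y; rewrite big_cons; case: (P i); rewrite ?add0r.
Qed.

Lemma continuous_prod (I : Type) (r : seq I) (P : pred I) (F : I -> X -> C) :
  (forall i, continuous (F i)) -> continuous (fun x => \prod_(i <- r | P i) F i x).
Proof.
move=> cF; elim: r => [|i r IH].
  rewrite (_ : (fun _ => _) = fun=> 1); first exact: continuous_cst.
  by apply/funext => y; rewrite big_nil.
rewrite (_ : (fun _ => _) =
    fun y => (if P i then F i y else 1) * \prod_(i <- r | P i) F i y).
  by apply: (continuous_mulc _ IH); case: (P i); [exact: cF|exact: continuous_cst].
by apply/funext => y; rewrite big_cons; case: (P i); rewrite ?mul1r.
Qed.

Lemma continuous_mulmx m n p (f : X -> 'M[C]_(m, n)) (g : X -> 'M[C]_(n, p)) :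
  continuous f -> continuous g -> continuous (fun x => f x *m g x).
Proof.
move=> cf cg; apply: continuous_mx => i j.
rewrite (_ : (fun _ => _) = fun x => \sum_k f x i k * g x k j); last first.
  by apply/funext => x; rewrite mxE.
by apply: continuous_sum => k; apply: continuous_mulc; exact: continuous_coord.
Qed.

Lemma continuous_addmx m n (f g : X -> 'M[C]_(m, n)) :
  continuous f -> continuous g -> continuous (fun x => f x + g x).
Proof.
move=> cf cg; apply: continuous_mx => i j.
rewrite (_ : (fun _ => _) = fun x => f x i j + g x i j); last first.
  by apply/funext => x; rewrite mxE.
exact: (continuous_addc (continuous_coord (i := i) (j := j) cf)
  (continuous_coord (i := i) (j := j) cg)).
Qed.

Lemma continuous_oppmx m n (f : X -> 'M[C]_(m, n)) :
  continuous f -> continuous (fun x => - f x).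
Proof.
move=> cf; apply: continuous_mx => i j.
rewrite (_ : (fun _ => _) = fun x => - f x i j); last first.
  by apply/funext => x; rewrite mxE.
exact: (continuous_oppc (continuous_coord (i := i) (j := j) cf)).
Qed.

Lemma continuous_trmx m n (f : X -> 'M[C]_(m, n)) :
  continuous f -> continuous (fun x => (f x)^T).
Proof.
move=> cf; apply: continuous_mx => i j.
rewrite (_ : (fun _ => _) = fun x => f x j i); last first.
  by apply/funext => x; rewrite mxE.
exact: continuous_coord.
Qed.

Lemma continuous_conjmx m n (f : X -> 'M[C]_(m, n)) :
  continuous f -> continuous (fun x => map_mx Num.Def.conjC (f x)).
Proof.
move=> cf; apply: continuous_mx => i j.
rewrite (_ : (fun _ => _) = fun x => Num.Def.conjC (f x i j)); last first.
  by apply/funext => x; rewrite mxE.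
by apply: continuous_conjc; exact: continuous_coord.
Qed.

Lemma continuous_det n (f : X -> 'M[C]_n) :
  continuous f -> continuous (fun x => \det (f x)).
Proof.
move=> cf; apply: continuous_sum => s.
apply: continuous_mulc; first exact: continuous_cst.
by apply: continuous_prod => i; exact: continuous_coord.
Qed.

(** By Cramer's rule. *)
Lemma continuous_invmx n (f : X -> 'M[C]_n) : (forall x, f x \in unitmx) ->
  continuous f -> continuous (fun x => invmx (f x)).
Proof.
move=> fu cf; apply: continuous_mx => i j.
rewrite (_ : (fun _ => _) = fun x =>
    (\det (f x))^-1 * ((-1) ^+ (j + i) * \det (row' j (col' i (f x))))); last first.
  by apply/funext => x; rewrite /invmx fu !mxE.
apply: continuous_mulc.
  apply: continuous_invc; last exact: continuous_det.
  by move=> x; have := fu x; rewrite unitmxE unitfE.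
apply: continuous_mulc; first exact: continuous_cst.
apply: continuous_det; apply: continuous_mx => a b.
rewrite (_ : (fun _ => _) = fun x => f x (lift j a) (lift i b)); last first.
  by apply/funext => y; rewrite !mxE.
exact: continuous_coord.
Qed.
Lemma continuous_block_mx p q r s (f : X -> 'M[C]_(p, r)) (g : X -> 'M[C]_(p, s))
    (h : X -> 'M[C]_(q, r)) (k : X -> 'M[C]_(q, s)) :
  continuous f -> continuous g -> continuous h -> continuous k ->
  continuous (fun x => block_mx (f x) (g x) (h x) (k x)).
Proof.
move=> cf cg ch ck; apply: continuous_mx => i j.
rewrite -(splitK i) -(splitK j).
case: (fintype.split i) (fintype.split j) => {}i [] {}j /=.
- rewrite (_ : (fun _ => _) = fun x => f x i j); last first.
    by apply/funext => x; rewrite block_mxEul.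
  exact: continuous_coord cf.
- rewrite (_ : (fun _ => _) = fun x => g x i j); last first.
    by apply/funext => x; rewrite block_mxEur.
  exact: continuous_coord cg.
- rewrite (_ : (fun _ => _) = fun x => h x i j); last first.
    by apply/funext => x; rewrite block_mxEdl.
  exact: continuous_coord ch.
- rewrite (_ : (fun _ => _) = fun x => k x i j); last first.
    by apply/funext => x; rewrite block_mxEdr.
  exact: continuous_coord ck.
Qed.
End ComplexMatrixContinuity.

(** * Continuity in Grassmannians *)

Lemma open_set_type (X : topologicalType) (A : set X) (U : set A) :
  open U <-> exists2 B : set X, open B & val @^-1` B = U.
Proof. by []. Qed.

Lemma continuous_to_set (X Y : topologicalType) (A : set Y) (f : X -> A) :
  continuous (fun x => \val (f x) : Y) -> continuous f.
Proof.
move=> cf; apply/continuousP => U /open_set_type[B oB <-].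
by move/continuousP: cf => /(_ B oB).
Qed.

Lemma continuous_to_prod (I : Type) (T : I -> topologicalType) (X : topologicalType)
    (f : X -> prod_topology T) :
  (forall i, continuous (fun x => f x i)) -> continuous f.
Proof.
move=> cf x; apply/cvg_sup => i U [B [[O oO <-] Ofx OU]].
have : nbhs x (f @^-1` ((fun g => g i) @^-1` O)).
  by apply: cf; apply: open_nbhs_nbhs; split.
by apply: filterS => y; exact: OU.
Qed.

Lemma continuous_val_coord (I : eqType) (T : I -> topologicalType)
    (A : set (prod_topology T)) i : continuous (fun x : A => val x i).
Proof.
move=> x; apply: (@continuous_comp _ _ _ (fun x : A => val x) (fun g => g i)).
  exact: initial_continuous.
exact: proj_continuous.
Qed.

Section Charts.
Context {R : realType} {E : vectType R[i]}.
Local Notation C := R[i].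
Local Notation d := (\dim {:E}).
Local Notation vb := (vbasis {:E}).
Let vb_basis : basis_of {:E} vb := vbasisP _.

Lemma frame_spanE k (A : frame (E := E) k) : frame_span A = row_space (\val A).
Proof.
apply/eqP; rewrite eqEsubv; apply/andP; split.
  apply/span_subvP => _ /mapP[i _ ->]; rewrite mem_row_space vecofK//.
  exact: row_sub.
rewrite /row_space vsof_sub// genmxE; apply/row_subP => i.
rewrite -mem_vecof//; apply: memv_span; apply/mapP; exists i => //.
by rewrite mem_enum.
Qed.

Lemma open_vspaceP (U : set {vspace E}) : open U <-> vspace_open U.
Proof. by []. Qed.

Definition coord_proj k (T : 'M[C]_(d, k)) (V : {vspace E}) : 'M[C]_k :=
  proj_ortho (msof vb V *m T).

(** Continuity out of a quotient is tested on frames, where the projector is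
    given by [proj_ortho_gram]. *)
Lemma continuous_coord_proj k (T : 'M[C]_(d, k)) : row_free T ->
  continuous (coord_proj T).
Proof.
move=> fT; apply/continuousP => O oO; apply/open_vspaceP => r.
pose h (A : frame (E := E) r) : 'M[C]_k := proj_ortho (\val A *m T).
rewrite (_ : _ @^-1` _ = h @^-1` O); last first.
  apply/seteqP; split=> A; rewrite /h /coord_proj /preimage/= frame_spanE.
    by rewrite (eq_proj_ortho (eqmxMr _ (msof_row_space _))).
  by rewrite (eq_proj_ortho (eqmxMr _ (msof_row_space _))).
suff : continuous h by move/continuousP; apply.
have fAT (A : frame (E := E) r) : row_free (\val A *m T).
  by rewrite /row_free mxrankMfree//; have /set_mem := valP A.
rewrite (_ : h = fun A => map_mx Num.Def.conjC (\val A *m T)^T *m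
   invmx ((\val A *m T) *m map_mx Num.Def.conjC (\val A *m T)^T) *m
   (\val A *m T)); last first.
  by apply/funext => A; rewrite /h proj_ortho_gram.
have cv : continuous (fun A : frame (E := E) r => \val A : 'M[C]_(r, d)).
  exact: initial_continuous.
have cA : continuous (fun A : frame (E := E) r => \val A *m T).
  by apply: continuous_mulmx => //; exact: continuous_cst.
have cAt : continuous (fun A : frame (E := E) r => map_mx Num.Def.conjC (\val A *m T)^T).
  by apply: continuous_conjmx; exact: continuous_trmx.
have cI := continuous_invmx (fun A => gram_unit (fAT A)) (continuous_mulmx cA cAt).
exact: continuous_mulmx (continuous_mulmx cAt cI) cA.
Qed.

(** Some k rows of [B x] are independent.  They remain independent near x, and
    span the row space as its dimension remains k: this is a continuous local
    lift to frames. *)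
Lemma continuous_row_space (X : topologicalType) m k (B : X -> 'M[C]_(m, d)) :
  continuous B -> (forall x, \rank (B x) = k) ->
  continuous (fun x => row_space (B x)).
Proof.
move=> cB rB; apply/continuousP => U oU; rewrite openE => x Ux.
have [g fg] : exists g : 'I_k -> 'I_m, row_free (rowsub g (B x)).
  by rewrite -(rB x); exists (maxrankfun (B x)); exact: maxrowsub_free.
have cG : continuous (fun y => rowsub g (B y)).
  apply: continuous_mx => i j.
  rewrite (_ : (fun _ => _) = fun y => B y (g i) j); last first.
    by apply/funext => y; rewrite !mxE.
  exact: continuous_coord.
have rowE' y (fy : row_free (rowsub g (B y))) :
    row_space (rowsub g (B y)) = row_space (B y).
  apply: eq_row_space; apply/eqmxP.
  have sub : (rowsub g (B y) <= B y)%MS by exact: rowsub_sub.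
  by rewrite -(mxrank_leqif_eq sub) rB; apply/eqP; apply/eqP.
have /open_set_type[O oO OU] := (open_vspaceP U).1 oU k.
have memO (y : X) (fy : row_free (rowsub g (B y))) :
    O (rowsub g (B y)) <-> U (row_space (B y)).
  pose A : frame (E := E) k :=
    exist (fun M => M \in [set M : 'M[C]_(k, d) | row_free M]) _ (mem_set fy).
  rewrite -(rowE' y fy) -[rowsub g (B y)]/(\val A) -frame_spanE.
  by have /seteqP[h1 h2] := OU; split; [exact: h1|exact: h2].
have nO : \forall y \near x, O (rowsub g (B y)).
  by apply: cG; apply: open_nbhs_nbhs; split=> //; apply/memO.
(* The determinant of the chosen rows times a fixed right inverse at x is 1
   at x, hence nonzero nearby. *)
have nfree : \forall y \near x, row_free (rowsub g (B y)).
  have /row_freeP[D BD] := fg.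
  pose f y := \det (rowsub g (B y) *m D).
  have cf : continuous f.
    by apply: continuous_det; apply: continuous_mulmx => //; exact: continuous_cst.
  have : \forall y \near x, f y != 0.
    by apply: near_neq0 => //; rewrite /f BD det1 oner_neq0.
  apply: filterS => y fy; apply/row_freeP; exists (D *m invmx (rowsub g (B y) *m D)).
  by rewrite mulmxA mulmxV// unitmxE unitfE.
apply: filterS2 nO nfree => y Oy fy; exact/memO.
Qed.
End Charts.

Section Coordinates.
Context {R : realType} {E : vectType R[i]} {k : nat} (b : k.-tuple E).
Hypothesis hb : basis_of {:E} b.
Local Notation C := R[i].
Local Notation vb := (vbasis {:E}).

(** A subspace is encoded by the orthogonal projector onto it, for the
    hermitian form that makes b orthonormal. *)
Definition coord_space (V : {vspace E}) : 'M[C]_k := coord_proj (basis_change vb b) V.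

Lemma continuous_coord_space : continuous coord_space.
Proof. exact: continuous_coord_proj (vbasis_change_free hb). Qed.

Lemma continuous_span_of (X : topologicalType) m r (B : X -> 'M[C]_(m, k)) :
  continuous B -> (forall x, \rank (B x) = r) ->
  continuous (fun x => span_of b (B x)).
Proof.
move=> cB rB; apply: (@continuous_row_space _ _ _ _ r).
  exact: continuous_mulmx cB (@continuous_cst _ _ _).
by move=> x; rewrite mxrankMfree ?basis_change_free.
Qed.

Lemma coord_spaceE V : (coord_space V :=: msof vb V *m basis_change vb b)%MS.
Proof. exact: proj_orthoE. Qed.

Lemma coord_spaceK V : span_of b (coord_space V) = V.
Proof.
rewrite (eq_span_of _ (coord_spaceE V)) /span_of -mulmxA basis_changeK// ?vbasisP//.
by rewrite mulmx1 row_space_msof.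
Qed.

Lemma span_ofK m (A : 'M[C]_(m, k)) : coord_space (span_of b A) = proj_ortho A.
Proof.
apply: eq_proj_ortho; apply: eqmx_trans (eqmxMr _ (msof_row_space _)) _.
by rewrite -mulmxA basis_changeK// ?vbasisP// mulmx1.
Qed.

Lemma proj_coord_space V : proj_ortho (coord_space V) = coord_space V.
Proof. by rewrite -span_ofK coord_spaceK. Qed.

Lemma sub_coord_space U V : (U <= V)%VS -> (coord_space U <= coord_space V)%MS.
Proof.
move=> UV; rewrite (coord_spaceE U) (coord_spaceE V); apply: submxMr.
by rewrite sub_msof ?vbasisP.
Qed.

Lemma stable_coord_space (z : 'End(E)) V : (z @: V <= V)%VS ->
  (coord_space V *m coord_mx b z <= coord_space V)%MS.
Proof. by move=> zV; rewrite -stable_span_of// coord_spaceK. Qed.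

Lemma rank_coord_space V : \rank (coord_space V) = \dim V.
Proof. by rewrite -{2}(coord_spaceK V) dim_span_of. Qed.
End Coordinates.

Section ProjectiveLine.
Context {R : realType} (b2 : 2.-tuple 'rV[R[i]]_2).
Hypothesis hb2 : basis_of {:'rV[R[i]]_2} b2.
Local Notation C := R[i].

Definition P1_proj (l : P1 R) : 'M[C]_2 := coord_space b2 (\val l).

Lemma P1_proj_line l : line_proj (P1_proj l).
Proof.
split; first exact: proj_coord_space.
by rewrite rank_coord_space//; have /set_mem := valP l.
Qed.

Lemma P1_proj_inj : injective P1_proj.
Proof.
move=> l l' ll'; apply: val_inj.
rewrite -(coord_spaceK hb2 (\val l)) -(coord_spaceK hb2 (\val l')).
by rewrite -[coord_space b2 (\val l)]/(P1_proj l) ll'.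
Qed.

Lemma P1_proj_surj P : line_proj P -> exists l, P1_proj l = P.
Proof.
move=> [eP rP]; have dP : \dim (span_of b2 P) = 1%N by rewrite dim_span_of.
exists (exist (fun V => V \in [set l : {vspace 'rV[C]_2} | \dim l = 1%N]) _ (mem_set dP)).
by rewrite /P1_proj /= span_ofK.
Qed.

Lemma continuous_P1_proj : continuous P1_proj.
Proof.
move=> l; apply: (@continuous_comp _ _ _
  (fun l : P1 R => \val l : {vspace 'rV[C]_2}) (coord_space b2)).
  exact: initial_continuous.
exact: continuous_coord_space.
Qed.

Lemma continuous_to_P1 (X : topologicalType) (f : X -> P1 R) :
  continuous (fun x => P1_proj (f x)) -> continuous f.
Proof.
move=> cf; apply: continuous_to_set.
rewrite (_ : (fun _ => _) = fun x => span_of b2 (P1_proj (f x))).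
  by apply: (continuous_span_of hb2 cf (r := 1%N)) => x; case: (P1_proj_line (f x)).
by apply/funext => x; rewrite /P1_proj coord_spaceK.
Qed.
End ProjectiveLine.

(** * Springer flags as words of lines *)

Lemma mem_take_enum_ord N j (i : 'I_N) : i \in take j (enum 'I_N) -> (i < j)%N.
Proof.
move=> /(nthP i)[k]; rewrite size_take_min size_enum_ord => kj.
rewrite nth_take; last by move: kj; lia.
by move=> /(congr1 val) /=; rewrite nth_enum_ord; move: kj; lia.
Qed.

Section FlagDimensions.
Context {R : realType} {E : vectType R[i]}.

(** The dimensions increase strictly in m steps, from at least 1 to m. *)
Lemma dim_complete_flag m (L : 'I_m -> {vspace E}) : \dim {:E} = m ->
  complete_flag L -> forall i, \dim (L i) = i.+1.
Proof.
move=> dm [L0 Llt Lfull].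
have lt (i j : 'I_m) : (i < j)%N -> (\dim (L i) < \dim (L j))%N.
  move=> ij; have [Lij nij] := Llt i j ij.
  rewrite ltn_neqAle dimvS// andbT; apply: contra nij.
  by have [_ ->] := dimv_leqif_eq Lij.
have low k (km : (k < m)%N) : (k < \dim (L (Ordinal km)))%N.
  elim: k km => [|k IH] km; first by rewrite lt0n dimv_eq0 L0.
  exact: leq_ltn_trans (IH (ltnW km)) (lt (Ordinal (ltnW km)) (Ordinal km) (ltnSn k)).
have high k (km : (k < m)%N) : (\dim (L (Ordinal km)) + (m - k.+1) <= m)%N.
  have [r] := ubnP (m - k.+1); elim: r k km => // r IH k km kr.
  have [km1|km1] := ltnP k.+1 m; last first.
    rewrite (eqP (_ : m - k.+1 == 0)%N) ?subn_eq0// addn0.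
    by rewrite -[X in (_ <= X)%N]dm dimvS ?subvf.
  have h := lt (Ordinal km) (Ordinal km1) (ltnSn k).
  by have := IH _ km1; lia.
move=> [k km]; apply/eqP; rewrite eqn_leq low andbT /=.
by have := high k km; lia.
Qed.
End FlagDimensions.

Section SpringerFiber.
Context {R : realType} {n' : nat} {E : vectType R[i]} (z : 'End(E)).
Local Notation C := R[i].
Local Notation n := n'.+1.
Local Notation N := (2 * n)%N.
Variables (b : (n + n).-tuple E) (b2 : 2.-tuple 'rV[C]_2).
Hypotheses (hb : basis_of {:E} b) (hb2 : basis_of {:'rV[C]_2} b2)
  (zb : coord_mx b z = two_shifts).

Local Notation word := (@word C (n + n) two_shifts amplify).

Let DZ := @amplify_shifts C n'.
Let iotaD := @chain_tops_amplify C n'.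
Let Zn := @two_shifts_nilpotent C n'.
Let genZ := @chain_tops_generate C n'.
Let freeZ := @chain_tops_free C n'.

Let NE : N = (n + n)%N. Proof. by rewrite mul2n addnn. Qed.

Lemma dimE : \dim {:E} = N.
Proof. by rewrite NE; have /andP[/eqP <- /eqP ->] := hb; rewrite size_tuple. Qed.

Definition line_word (l : 'I_N -> P1 R) : seq 'M[C]_2 :=
  [seq P1_proj b2 (l i) | i <- enum 'I_N].

Definition word_mx (l : 'I_N -> P1 R) j : 'M[C]_(n + n) :=
  word false (take j (line_word l)).

(** The flag has its terms in increasing order: the one with index i has
    dimension i+1 and codimension [rev_ord i]. *)
Definition word_flag_of (l : 'I_N -> P1 R) (i : 'I_N) : {vspace E} :=
  span_of b (word_mx l (rev_ord i)).

Lemma size_line_word l : size (line_word l) = (n + n)%N.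
Proof. by rewrite size_map size_enum_ord NE. Qed.

Lemma line_word_proj l : {in line_word l, forall P, line_proj P}.
Proof. by move=> _ /mapP[i _ ->]; exact: P1_proj_line. Qed.

Lemma nth_line_word l (i : 'I_N) : (line_word l)`_i = P1_proj b2 (l i).
Proof.
rewrite /line_word (nth_map i); last by rewrite size_enum_ord.
by rewrite nth_ord_enum.
Qed.

Lemma word_mx_full l : word_mx l N = word false (line_word l).
Proof. by rewrite /word_mx take_oversize// size_line_word NE. Qed.

(** A word of 2n letters that cancels completely is t^n. *)
Lemma S_tilde_word (l : 'I_N -> P1 R) : S_tilde R n l <-> word_mx l N = 0.
Proof.
have -> : S_tilde R n l <-> reducible (line_word l).
  rewrite -(constant_on_matching (fun i => P1_proj b2 (l i))).
  split=> [[a ca la]|[a ca la]].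
    by exists a; [exact: ca|move=> j ja; congr (P1_proj b2 _); exact: la].
  by exists a; [exact: ca|move=> j ja; apply: (P1_proj_inj hb2); exact: la].
rewrite word_mx_full; split=> [r|w].
  rewrite (word_reducible DZ _ (@line_word_proj l) r).
  have -> : (size (line_word l))./2 = n by rewrite size_line_word addnn doubleK.
  exact: Zn.
apply: (reducible_word DZ iotaD Zn freeZ (m := n) (b := false)) => //.
- by rewrite size_line_word addnn.
- exact: line_word_proj.
by rewrite w mulr0.
Qed.

Lemma word_mx_flag l : word_mx l N = 0 -> descending_flag two_shifts (word_mx l).
Proof.
rewrite word_mx_full => w.
exact: (word_flag DZ iotaD genZ (size_line_word l) (@line_word_proj l) w).
Qed.

Lemma descending_flag_mono V i j : descending_flag (C := C) (two_shifts (n' := n')) V ->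
  (i <= j)%N -> (j <= n + n)%N -> (V j <= V i)%MS.
Proof.
move=> [_ dV _]; elim: j => [|j IH]; first by rewrite leqn0 => /eqP->.
rewrite leq_eqVlt => /orP[/eqP->//|ij] jn.
exact: submx_trans (dV _ jn) (IH ij (ltnW jn)).
Qed.

Lemma word_flag_Springer l : word_mx l N = 0 -> Springer n z (word_flag_of l).
Proof.
move=> /word_mx_flag fl; have [rV dV sV] := fl.
have rk (i : 'I_N) : \dim (word_flag_of l i) = i.+1.
  by rewrite dim_span_of// rV /=; have := ltn_ord i; lia.
split; first split.
- by move=> j j0; rewrite -dimv_eq0 rk.
- move=> i j ij; split.
    rewrite sub_span_of//; apply: (descending_flag_mono fl) => /=;
    by have := ltn_ord i; have := ltn_ord j; lia.
  by apply/eqP => e; have := rk i; rewrite e rk; lia.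
- by move=> j jN; apply/eqP; rewrite eqEdim subvf dimE rk jN leqnn.
- by move=> j; rewrite stable_span_of// zb; apply: sV => /=; have := ltn_ord j; lia.
Qed.

(** Codimension 2n corresponds to the zero space, which a complete flag
    leaves out. *)
Definition rev_flag (L : 'I_N -> {vspace E}) j : 'M[C]_(n + n) :=
  if insub j is Some i then coord_space b (L (rev_ord i)) else 0.

Lemma rev_flagE L (i : 'I_N) : rev_flag L i = coord_space b (L (rev_ord i)).
Proof. by rewrite /rev_flag valK. Qed.

Lemma rev_flag0 L j : (N <= j)%N -> rev_flag L j = 0.
Proof. by move=> Nj; rewrite /rev_flag insubF// ltnNge Nj. Qed.

Lemma Springer_rev_flag L : Springer n z L -> descending_flag two_shifts (rev_flag L).
Proof.
move=> [cL sL]; have dL := dim_complete_flag dimE cL.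
have [_ Llt _] := cL.
have ordP j : (j < N)%N -> exists i : 'I_N, j = i by move=> h; exists (Ordinal h).
split=> j jd; have [Nj|/ordP[i ji]] := leqP N j.
- by rewrite rev_flag0// mxrank0; lia.
- by rewrite ji rev_flagE rank_coord_space// dL /=; have := ltn_ord i; lia.
- by rewrite rev_flag0 ?sub0mx//; lia.
- rewrite ji; have [Nj|/ordP[k jk]] := leqP N i.+1; first by rewrite rev_flag0 ?sub0mx.
  rewrite jk !rev_flagE; apply: sub_coord_space; apply: (Llt _ _ _).1 => /=.
  by have := ltn_ord k; lia.
- by rewrite rev_flag0// mul0mx sub0mx.
- by rewrite ji rev_flagE -zb; apply: stable_coord_space.
Qed.

Lemma exists_line_word L : Springer n z L ->
  exists2 l : 'I_N -> P1 R, S_tilde R n l & forall i, L i = word_flag_of l i.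
Proof.
move=> SL; have [s [sd ls ws]] := exists_word DZ iotaD genZ Zn (Springer_rev_flag SL).
have /choice[l lE] : forall i : 'I_N, exists l, P1_proj b2 l = s`_i.
  by move=> i; apply: (P1_proj_surj hb2); apply/ls/mem_nth; rewrite sd -NE.
have sE : s = line_word l.
  apply: (@eq_from_nth _ 0); first by rewrite sd size_line_word.
  move=> k; rewrite sd -NE => hi.
  by rewrite -[k]/(nat_of_ord (Ordinal hi)) nth_line_word lE.
exists l.
  apply/S_tilde_word; apply/eqP; rewrite -submx0 -(rev_flag0 L (leqnn _)).
  by rewrite /word_mx -sE ws// NE.
move=> i; rewrite /word_flag_of /word_mx -sE (eq_span_of _ (ws _ _)).
  by rewrite rev_flagE coord_spaceK// rev_ordK.
by rewrite -NE ltnW.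
Qed.

(** The lines are recovered from the flag one after the other, as each is
    determined by the flag and the preceding lines.  Both the injectivity and
    the continuity of the map from flags to lines rest on this formula. *)
Lemma line_of_flag L l (j : 'I_N) : Springer n z L ->
  (forall i, L i = word_flag_of l i) -> S_tilde R n l ->
  P1_proj b2 (l j) =
    twist (odd j) (next_line chain_tops (word_mx l j) (rev_flag L j.+1)).
Proof.
move=> SL Ll /S_tilde_word wl; rewrite -nth_line_word.
apply: (word_next_line DZ iotaD genZ Zn (Springer_rev_flag SL)).
- exact: size_line_word.
- exact: line_word_proj.
- move=> k kn; have := kn; rewrite -[X in (k <= X)%N]NE leq_eqVlt => /orP[/eqP->|kN].
    by rewrite -/(word_mx l N) wl rev_flag0.
  rewrite -[k]/(nat_of_ord (Ordinal kN)) rev_flagE Ll /word_flag_of rev_ordK span_ofK//.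
  by apply: eqmx_sym; exact: proj_orthoE.
- by rewrite -NE.
Qed.

Lemma eq_word_mx l l' j : (forall i : 'I_N, (i < j)%N -> l i = l' i) ->
  word_mx l j = word_mx l' j.
Proof.
move=> ll; apply: (congr1 (word false)); rewrite /line_word.
rewrite -[LHS]map_take -[RHS]map_take.
by apply/eq_in_map => i /mem_take_enum_ord /ll ->.
Qed.

Lemma line_word_uniq L l l' : Springer n z L -> S_tilde R n l -> S_tilde R n l' ->
  (forall i, L i = word_flag_of l i) -> (forall i, L i = word_flag_of l' i) -> l = l'.
Proof.
move=> SL Sl Sl' Ll Ll'; apply/funext => i.
have [k] := ubnP (nat_of_ord i); elim: k i => // k IH i ik.
apply: (P1_proj_inj hb2).
apply: (etrans (line_of_flag i SL Ll Sl)).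
apply: (etrans _ (esym (line_of_flag i SL Ll' Sl'))).
apply: (congr1 (fun G => twist (odd i) (next_line chain_tops G (rev_flag L i.+1)))).
by apply: eq_word_mx => j ji; apply: IH; lia.
Qed.

Lemma continuous_amplify (X : topologicalType) (f : X -> 'M[C]_2) :
  continuous f -> continuous (fun x => amplify (f x) : 'M[C]_(n + n)).
Proof.
move=> cf; have cs i j : continuous (fun x => (f x i j)%:M : 'M[C]_n).
  apply: continuous_mx => k l.
  rewrite (_ : (fun _ => _) = fun x => f x i j * (k == l)%:R); last first.
    by apply/funext => x; rewrite mxE mulr_natr.
  apply: (@continuous_mulc R X (fun x => f x i j) (fun=> (k == l)%:R)).
    exact: (continuous_coord (i := i) (j := j) cf).
  exact: continuous_cst.
exact: continuous_block_mx (cs 0 0) (cs 0 1) (cs 1 0) (cs 1 1).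
Qed.

Lemma continuous_submx (X : topologicalType) p q (f g : X -> 'M[C]_(p, q)) :
  continuous f -> continuous g -> continuous (fun x => f x - g x).
Proof. by move=> cf cg; exact: continuous_addmx cf (continuous_oppmx cg). Qed.

Lemma continuous_twist (X : topologicalType) c (f : X -> 'M[C]_2) :
  continuous f -> continuous (fun x => twist c (f x) : 'M[C]_2).
Proof.
move=> cf; case: c; last exact: cf.
exact: continuous_submx (@continuous_cst X _ (1 : 'M[C]_2)) cf.
Qed.

Lemma continuous_word (X : topologicalType) c (s : seq (X -> 'M[C]_2)) :
  (forall k, continuous (nth (fun=> 0) s k)) ->
  continuous (fun x => word c [seq f x | f <- s] : 'M[C]_(n + n)).
Proof.
elim: s c => [|f s IH] c cs /=; first exact: continuous_cst.
have cf : continuous (fun x => twist c (f x) : 'M[C]_2).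
  by apply: continuous_twist; exact: (cs 0%N).
have cw : continuous (fun x => word (~~ c) [seq f x | f <- s] : 'M[C]_(n + n)).
  by apply: IH => k; exact: (cs k.+1).
apply: (continuous_mulmx cw); apply: (continuous_addmx (continuous_amplify cf)).
apply: (continuous_mulmx (@continuous_cst _ _ _)); apply: continuous_amplify.
exact: continuous_submx (@continuous_cst _ _ _) cf.
Qed.

Lemma continuous_word_mx (X : topologicalType) (l : X -> 'I_N -> P1 R) j :
  (forall i : 'I_N, (i < j)%N -> continuous (fun x => l x i)) ->
  continuous (fun x => word_mx (l x) j).
Proof.
move=> cl; pose s := [seq (fun x => P1_proj b2 (l x i)) | i <- take j (enum 'I_N)].
rewrite (_ : (fun _ => _) = fun x => word false [seq f x | f <- s] : 'M[C]_(n + n)).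
  apply: continuous_word => k; have [sk|ks] := leqP (size s) k.
    by rewrite nth_default//; exact: continuous_cst.
  have := ks; rewrite size_map => ks'.
  have x0 : 'I_N by case: (take _ _) ks' => // i.
  rewrite (nth_map x0)// => x.
  apply: (@continuous_comp _ _ _
    (fun x => l x (nth x0 (take j (enum 'I_N)) k)) (P1_proj b2)).
    by apply: cl; apply: mem_take_enum_ord; exact: mem_nth.
  exact: (continuous_P1_proj hb2).
by apply/funext => x; rewrite /word_mx /line_word -map_take /s -map_comp.
Qed.

Lemma continuous_word_flag_of (X : topologicalType) (l : X -> 'I_N -> P1 R) :
  (forall i, continuous (fun x => l x i)) -> (forall x, S_tilde R n (l x)) ->
  forall i, continuous (fun x => word_flag_of (l x) i).
Proof.
move=> cl Sl i; apply: (continuous_span_of hb (r := i.+1)).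
  by apply: continuous_word_mx => j _.
move=> x; have /S_tilde_word/word_mx_flag[rV _ _] := Sl x.
by rewrite rV /=; have := ltn_ord i; lia.
Qed.

Lemma continuous_rev_flag (X : topologicalType) (L : X -> 'I_N -> {vspace E}) j :
  (forall i, continuous (fun x => L x i)) -> continuous (fun x => rev_flag (L x) j).
Proof.
move=> cL; rewrite /rev_flag; case: insubP => [i _ _|_]; last exact: continuous_cst.
move=> x; apply: (@continuous_comp _ _ _ (fun x => L x (rev_ord i)) (coord_space b)).
  exact: cL.
exact: continuous_coord_space.
Qed.

(** By induction on i: the formula [line_of_flag] presents the i-th line as
    the row space of a matrix B of constant rank one which involves only the
    flag and the preceding lines. *)
Lemma continuous_lines_of_flag (X : topologicalType) (L : X -> 'I_N -> {vspace E})
    (l : X -> 'I_N -> P1 R) :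
  (forall i, continuous (fun x => L x i)) -> (forall x, Springer n z (L x)) ->
  (forall x, S_tilde R n (l x)) -> (forall x i, L x i = word_flag_of (l x) i) ->
  forall i, continuous (fun x => l x i).
Proof.
move=> cL SL Sl Ll i; have [k] := ubnP (nat_of_ord i); elim: k i => // k IH i ik.
apply: (continuous_to_P1 hb2).
have cw : continuous (fun x => word_mx (l x) i).
  by apply: continuous_word_mx => j ji; apply: IH; lia.
pose B x : 'M[C]_(n + n, 2) := (chain_tops *m word_mx (l x) i *m
  (1%:M - proj_ortho (rev_flag (L x) i.+1)))^T *m rot2.
have pE x : proj_ortho (rev_flag (L x) i.+1) = rev_flag (L x) i.+1.
  rewrite /rev_flag; case: insubP => [j _ _|_]; first exact: proj_coord_space.
  by apply/eqP; rewrite -submx0 proj_orthoE.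
have PB x : P1_proj b2 (l x i) = twist (odd i) (coord_space b2 (span_of b2 (B x))).
  by rewrite (line_of_flag i (SL x) (Ll x) (Sl x)) span_ofK.
rewrite (_ : (fun _ => _) = fun x =>
    twist (odd i) (coord_space b2 (span_of b2 (B x))) : 'M[C]_2); last first.
  by apply/funext => x; exact: PB.
apply: continuous_twist => x.
apply: (@continuous_comp _ _ _ (fun x => span_of b2 (B x)) (coord_space b2)); last first.
  exact: continuous_coord_space.
apply: (continuous_span_of hb2 (r := 1%N)).
  apply: continuous_mulmx; last exact: continuous_cst.
  apply: continuous_trmx; apply: continuous_mulmx.
    exact: continuous_mulmx (@continuous_cst _ _ _) cw.
  apply: continuous_submx; first exact: continuous_cst.
  rewrite (_ : (fun _ => _) = fun x => rev_flag (L x) i.+1); last by apply/funext => y.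
  exact: continuous_rev_flag.
move=> {}x; have := line_twist (odd i) (P1_proj_line hb2 (l x i)).
by rewrite PB twistK span_ofK// => -[_]; rewrite proj_orthoE.
Qed.
End SpringerFiber.

Theorem theorem1p2 (R : realType) (n : nat) (E : vectType R[i]) (z : 'End(E)) :
  (1 <= n)%N ->
  \dim {:E} = (2 * n)%N ->
  two_equal_Jordan_blocks n z ->
  homeomorphic (Springer n z) (S_tilde R n).
Proof.
case: n => // n' _ dE [e [f [hb ze zf]]].
have zb := coord_mx_Jordan hb ze zf; pose b := cat_tuple e f.
have d2 : \dim {:'rV[R[i]]_2} = 2%N by rewrite dimvf dim_matrix.
pose b2 := tcast d2 (vbasis {:'rV[R[i]]_2}).
have hb2 : basis_of {:'rV[R[i]]_2} b2 by rewrite /b2 val_tcast vbasisP.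
have fP (L : Springer n'.+1 z) :
    exists l : S_tilde R n'.+1, forall i, val L i = word_flag_of b b2 (val l) i.
  have [l Sl Ll] := exists_line_word hb hb2 zb (set_mem (valP L)).
  by exists (exist (fun l => l \in S_tilde R n'.+1) l (mem_set Sl)).
have /choice[F FE] := fP.
have gP (l : S_tilde R n'.+1) : Springer n'.+1 z (word_flag_of b b2 (val l)).
  apply: (word_flag_Springer hb hb2 zb); apply/(S_tilde_word hb2).
  exact: set_mem (valP l).
pose G (l : S_tilde R n'.+1) : Springer n'.+1 z :=
  exist (fun L => L \in Springer n'.+1 z) _ (mem_set (gP l)).
exists F, G; split.
- by move=> L; apply: val_inj; apply/funext => i; rewrite /= -FE.
- move=> l; apply: val_inj.
  have SG := set_mem (valP (G l)).
  exact: (line_word_uniq hb hb2 zb SG (set_mem (valP (F (G l)))) (set_mem (valP l))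
    (FE (G l)) (fun=> erefl)).
- apply: continuous_to_set; apply: continuous_to_prod => i.
  exact: (continuous_lines_of_flag hb hb2 zb (@continuous_val_coord _ _ _)
    (fun L => set_mem (valP L)) (fun L => set_mem (valP (F L))) FE).
- apply: continuous_to_set; apply: continuous_to_prod => i.
  exact: (continuous_word_flag_of hb hb2 (@continuous_val_coord _ _ _)
    (fun l => set_mem (valP l))).
Qed.
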